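(* Let $F_0$, $\Omega_0$, $\Gamma$, $\hat\Gamma$, $\Gamma_t$, $F(z,t)$, $u(t)$ and $f(z,t)=F^{-1}(F_0(z),t)$ be as described in the context, so that $F$ solves the Löwner PDE $$\dot F(z,t)=zF'(z,t)\frac{e^{iu(t)}+z}{e^{iu(t)}-z}$$ and $f$ solves the Löwner ODE $$\frac{df}{dt}=-f\,\frac{e^{iu(t)}+f}{e^{iu(t)}-f},\qquad f(z,0)\equiv z,$$ with the same continuous driving term $u$, and $F(\mathbb D,0)=\Omega_0$ is bounded by $\hat\Gamma$. (i) If $\hat\Gamma$ meets itself once, then $f$ does not represent a slit evolution at any time $t>0$; moreover, for every $t>0$ the set $\mathbb D\setminus f(\mathbb D,t)$ has non-zero area and $f(\cdot,t)$ is not a slit map. (ii) If $\hat\Gamma$ does not meet itself (i.e. it is a simple, Jordan, arc), then $f$ represents a slit evolution.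
   Context: $\mathbb D=\{z\in\mathbb C:|z|<1\}$, $\mathbb T=\partial\mathbb D$. Dots and primes denote derivatives in $t$ and $z$ respectively. Setting. $F_0(z)=z+a_2z^2+\dots$ is a conformal map of $\mathbb D$ onto a domain $\Omega_0\subset\mathbb C$, $0\in\Omega_0$, bounded by a curve $\Gamma=\{\Gamma(t):t\in(0,\infty)\}$ which is a homeomorphic image of the open interval $(0,\infty)$ and whose closure $\hat\Gamma$ (in the Riemann sphere) is $\partial\Omega_0$. The right endpoint $\infty$ of the parameter interval corresponds to the point $\infty\in\hat\Gamma$, i.e. $\Gamma(t)\to\infty$ as $t\to\infty$ (write $\Gamma(\infty)=\infty$), and $\lim_{t\to+0}\Gamma(t)$ exists. One says that $\hat\Gamma$ meets itself once (possibly at infinity) if there is $t_0\in(0,\infty]$ such that $\Gamma(t_0)=\lim_{t\to+0}\Gamma(t)$; in that case the complement of $\Omega_0\cup\hat\Gamma$ has non-zero (possibly infinite) area. Otherwise $\hat\Gamma$ does not meet itself. Put $\Gamma_t=\Gamma([t,\infty))$. The parametrization of $\Gamma$ is chosen so that for each $t\in(0,\infty)$ the conformal radius of $\mathbb C\setminus\Gamma_t$ with respect to $0$ equals $e^t$. For $t>0$, $F(\cdot,t)$ is the conformal map of $\mathbb D$ onto $\mathbb C\setminus\Gamma_t$ with $F(z,t)=e^tz+a_2(t)z^2+\dots$, and $F(\cdot,0)=F_0$. This is a subordination chain satisfying the Löwner PDE with some continuous real-valued driving term $u(t)$, $t\in[0,\infty)$. The functions $f(z,t)=F^{-1}(F_0(z),t)$,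 $z\in\mathbb D$, where $F^{-1}(\cdot,t)$ is the inverse of $F(\cdot,t)$, satisfy the Löwner ODE with the same $u$. $f(\cdot,t)$ is a slit map if $f(\mathbb D,t)$ is $\mathbb D$ minus a slit along a simple (Jordan) arc in $\mathbb D$ starting at a point of $\mathbb T$; $f$ represents a slit evolution if $f(\cdot,t)$ is a slit map for every $t>0$. *)

(* Defs.v *)
From HB Require Import structures.
From mathcomp Require Import all_boot all_order all_algebra.
From mathcomp Require Import complex.
From mathcomp Require Import all_classical all_reals all_analysis.

Set Implicit Arguments.
Unset Strict Implicit.
Unset Printing Implicit Defensive.

Import Order.TTheory GRing.Theory Num.Theory.
Import numFieldNormedType.Exports.

Local Open Scope complex_scope.
Local Open Scope ring_scope.
Local Open Scope classical_set_scope.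

(* The library only gives its norm topology to the alias [R[i]^o].  As a normed
   module over itself, [R[i]] makes [derivable g z 1] and [derive1 g z] complex
   differentiability and the complex derivative. *)
HB.instance Definition _ (R : realType) := NormedModule.copy R[i] (R[i])^o.

Definition disk (R : realType) : set R[i] := [set z | `|z| < 1].

Notation sphere R := (one_point_compactification R[i]).

Definition to_sphere (R : realType) (z : R[i]) : sphere R := Some z.

Definition sphere_oo (R : realType) : sphere R := None.

Definition boundary (T : topologicalType) (A : set T) : set T :=
  closure A `\` interior A.

Definition is_domain (R : realType) (U : set R[i]) : Prop :=
  [/\ U !=set0, open U & connected U].

Definition conformal_map (R : realType) (U V : set R[i]) (g : R[i] -> R[i]) :
    Prop :=
  (forall z, U z -> derivable g z 1) /\ set_bij U V g.

Definition has_conformal_radius (R : realType) (U : set R[i]) (w : R[i])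
    (r : R) : Prop :=
  exists g : R[i] -> R[i],
    [/\ conformal_map (@disk R) U g, g 0 = w & `|derive1 g 0| = r%:C].

Definition expi (R : realType) (x : R) : R[i] := cos x +i* sin x.

(* Two-dimensional Lebesgue measure, identifying x + iy with (x, y). *)
Definition area (R : realType) (A : set R[i]) : \bar R :=
  ((@lebesgue_measure R) \x (@lebesgue_measure R))%E
    [set p | A (p.1 +i* p.2)].

(* The derivative at [t] of a path defined on [0, +oo[; one-sided at [t = 0]. *)
Definition has_time_derivative (R : realType) (g : R -> R[i]) (t : R)
    (l : R[i]) : Prop :=
  (g s - g t) / (s - t)%:C @[s --> within [set s | 0 <= s] t^'] --> l.

(* A curve with parameter interval ]0, +oo[; values at [t <= 0] are ignored.
   Only continuity and injectivity are required, not that the inverse be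
   continuous for the subspace topology of the image: the latter fails exactly
   when the limit of the curve at 0 is one of its (finite) points. *)
Definition open_curve (R : realType) (Gamma : R -> R[i]) : Prop :=
  {within `]0, +oo[, continuous Gamma} /\ set_inj `]0, +oo[ Gamma.

Definition curve_to_sphere (R : realType) (Gamma : R -> R[i]) (t : R) :
  sphere R := to_sphere (Gamma t).

Definition curve_hat (R : realType) (Gamma : R -> R[i]) : set (sphere R) :=
  closure (curve_to_sphere Gamma @` `]0, +oo[).

Definition curve_tail (R : realType) (Gamma : R -> R[i]) (t : R) : set R[i] :=
  Gamma @` `[t, +oo[.

(* Only meaningful on ]0, +oo]; the value at [-oo] is junk. *)
Definition curve_extended (R : realType) (Gamma : R -> R[i]) (t : \bar R) :
    sphere R :=
  if t is EFin s then curve_to_sphere Gamma s else sphere_oo R.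

Definition meets_itself_once (R : realType) (Gamma : R -> R[i]) : Prop :=
  exists2 t0 : \bar R, (0 < t0)%E &
    curve_to_sphere Gamma t @[t --> 0^'+] --> curve_extended Gamma t0.

(* [gamma] restricted to ]0, 1] is a simple arc in the disk, tip included, which
   starts at the point [gamma 0] of the unit circle. *)
Definition is_slit (R : realType) (gamma : R -> R[i]) : Prop :=
  [/\ {within `[0, 1], continuous gamma}, set_inj `[0, 1] gamma,
      `|gamma 0| = 1 & forall s, 0 < s <= 1 -> disk (gamma s)].

Definition is_slit_map (R : realType) (g : R[i] -> R[i]) : Prop :=
  exists2 gamma : R -> R[i], is_slit gamma &
    g @` (@disk R) = @disk R `\` gamma @` `]0, 1].

Definition slit_evolution (R : realType) (f : R[i] -> R -> R[i]) : Prop :=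
  forall t : R, 0 < t -> is_slit_map (f^~ t).

(* Main.v *)
Require Import Defs.
From HB Require Import structures.
From mathcomp Require Import all_boot all_order all_algebra.
From mathcomp Require Import complex.
From mathcomp Require Import all_classical all_reals all_analysis.
From mathcomp Require Import ring lra.

(* All the topology is done with continuous square roots in place of logarithms.

   (i) Let Gamma(0+) = Gamma(t0) and 0 < tau < t0. The function z - Gamma(tau) has
   a continuous square root off Gamma([tau, oo[), which is a conformal image of the
   disk, and, by a homotopy along Gamma(]0, tau]), also off the closed set
   Gamma(]0, tau] u [t0, oo[). If Omega0 were the whole complement of the curve, the
   two roots would agree up to sign on the connected set Omega0, hence glue to a
   square root on a small circle around Gamma(tau), which does not exist. So the
   complement of Omega0 and of the curve contains an open set, whose preimage under
   F(., t) is an open subset of the complement of f(D, t).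

   (ii) An arc does not separate the plane, so Omega0 is the complement of the
   curve and f(D, t) is D minus the preimage of Gamma([0, t[). That this preimage
   lands at exp(i u(t)) follows from the Loewner ODE for f: a trajectory that stays
   away from the driving point cannot leave the unit circle in a short time. The
   inverse of F(., t) is continuous by invariance of domain, proved as in Borsuk's
   odd map argument. *)

Set Implicit Arguments.
Unset Strict Implicit.
Unset Printing Implicit Defensive.

Import Order.TTheory GRing.Theory Num.Theory.
Import numFieldNormedType.Exports.

Local Open Scope complex_scope.
Local Open Scope ring_scope.
Local Open Scope classical_set_scope.

(** * The topology of the complex plane *)

(** The curve is studied through [eta = 1 / Gamma], reparametrized over [0, 1]. This is legitimate
    because the curve lies in the boundary of the open set [Omega0], which contains 0. Infinity
    becomes the value 0, so returning to a finite point and returning to infinity are one equation,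
    [eta 0 = eta s0]. The parameter interval becomes compact, which makes the set of points missing
    a closed piece of the curve open. The equation [z * eta s = 1] replaces [z = Gamma t], and
    [1 - z * eta s] replaces [z - Gamma t] up to a constant factor.

    A homotopy through nonvanishing maps only yields a root of the quotient of its two end maps.
    Roots are therefore assembled as products of such quotients, which telescope, with a constant or
    a root already known. In the three plane topology arguments (open maps, closed curves, arcs) the
    product is a root of an odd nonvanishing map on a circle, which is absurd. *)

Lemma nbhs_complexP (R : realType) (z : R[i]) (A : set R[i]) :
  nbhs z A <-> exists2 e : R, 0 < e & forall w, `|z - w| < e%:C -> A w.
Proof.
split=> [/nbhs_normP[[e e'] /= e0 H]|[e e0 H]].
  move: e0; rewrite ltcE /= => /andP[/eqP e'0 e0].
  by exists e => // w zw; apply: H; rewrite /= e'0.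
by apply/nbhs_normP; exists (e%:C) => //=; rewrite ltcR.
Qed.

Lemma near_complex (R : realType) (z : R[i]) (e : R) :
  0 < e -> \forall w \near z, `|z - w| < e%:C.
Proof. by move=> e0; apply/nbhs_complexP; exists e. Qed.

Lemma cvg_complexP (R : realType) (T : Type) (F : set_system T)
    (FF : Filter F) (g : T -> R[i]) (l : R[i]) :
  g @ F --> l <-> forall e : R, 0 < e -> \forall x \near F, `|l - g x| < e%:C.
Proof.
split=> [gl e e0|H A /nbhs_complexP[e e0 eA]].
  exact: (gl _ (near_complex l e0)).
by move: (H _ e0); apply: filterS => x /eA.
Qed.

Lemma Re_continuous (R : realType) : continuous (@complex.Re R : R[i] -> R).
Proof.
move=> z; apply/(@cvgrPdist_lt _ _ _ (nbhs z) (nbhs_filter z)) => e e0.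
apply: (@filterS _ (nbhs z) _ _ _ _ (near_complex z e0)) => w /= zw.
rewrite -(raddfB (@complex.Re R)) -ltcR.
exact: le_lt_trans (normc_ge_Re _) zw.
Qed.

Lemma Im_continuous (R : realType) : continuous (@complex.Im R : R[i] -> R).
Proof.
have E : (@complex.Im R : R[i] -> R) = fun z => complex.Re (- 'i * z).
  by apply/funext => -[a b] /=; rewrite oppr0 mul0r mulN1r opprK add0r.
rewrite E => z; 
apply: (@continuous_comp _ _ _ (fun z : R[i] => - 'i * z)); last exact: Re_continuous.
exact: mulrl_continuous.
Qed.

Lemma realC_continuous (R : realType) : continuous (fun x : R => x%:C : R[i]).
Proof.
move=> x; apply/cvg_complexP => e e0.
near=> y.
rewrite -rmorphB normc_def /= expr0n addr0 sqrtr_sqr ltcR.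
near: y; exact: cvgr_dist_lt.
Unshelve. all: by end_near. Qed.

Lemma Complex_continuous (R : realType) :
  continuous (fun p : R * R => p.1 +i* p.2 : R[i]).
Proof.
have E : (fun p : R * R => p.1 +i* p.2 : R[i]) = fun p => p.1%:C + 'i * p.2%:C.
  by apply/funext => -[a b] /=; rewrite [LHS]complexE.
rewrite E => p; apply: cvgD.
  apply: (@continuous_comp _ _ _ (@fst R R)); last exact: realC_continuous.
  exact: cvg_fst.
apply: cvgMr.
apply: (@continuous_comp _ _ _ (@snd R R)); last exact: realC_continuous.
exact: cvg_snd.
Qed.

Lemma continuous_Complex (R : realType) (T : topologicalType) (a b : T -> R) x :
  {for x, continuous a} -> {for x, continuous b} ->
  {for x, continuous (fun y => a y +i* b y)}.
Proof.
move=> ca cb.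
apply: (@continuous_comp _ _ _ (fun y => (a y, b y))
  (fun p : R * R => p.1 +i* p.2)); last exact: Complex_continuous.
exact: (@cvg_pair _ _ _ (nbhs x) (nbhs (a x)) (nbhs (b x)) _ _ _ _ _ ca cb).
Qed.

Lemma expi_continuous (R : realType) : continuous (@expi R).
Proof.
move=> x; apply: (@continuous_Complex R _ cos sin x).
  exact: continuous_cos.
exact: continuous_sin.
Qed.

Lemma norm_expi (R : realType) (x : R) : `|expi x| = 1.
Proof. by rewrite normc_def /= cos2Dsin2 sqrtr1. Qed.

(* Pointwise continuity rules for complex ([ccont]) and real ([rcont]) valued
   maps. Stated at fixed types because the generic rules make unification unfold
   the topology of [R[i]]. *)
Lemma ccont_id (R : realType) (z : R[i]) : {for z, continuous (fun y : R[i] => y)}.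
Proof. by move=> A. Qed.
Lemma ccont_cst (R : realType) (T : topologicalType) (x : T) (c : R[i]) : {for x,
  continuous (fun _ : T => c)}.
Proof. by move=> A; exact: cvg_cst. Qed.
Section ccont.
Context (R : realType) (T : topologicalType) (f g : T -> R[i]) (x : T).
Hypothesis cf : {for x, continuous f}.
Hypothesis cg : {for x, continuous g}.
Lemma ccontD : {for x, continuous (fun y => f y + g y)}.
Proof. exact: (continuousD cf cg). Qed.
Lemma ccontN : {for x, continuous (fun y => - f y)}.
Proof. exact: (continuousN cf). Qed.
Lemma ccontB : {for x, continuous (fun y => f y - g y)}.
Proof. exact: (continuousB cf cg). Qed.
Lemma ccontM : {for x, continuous (fun y => f y * g y)}.
Proof. exact: (continuousM cf cg). Qed.
Lemma ccontV : f x != 0 -> {for x, continuous (fun y => (f y)^-1)}.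
Proof. by move=> f0; exact: (continuousV f0 cf). Qed.
Lemma ccont_norm : {for x, continuous (fun y => `|f y|)}.
Proof. exact: (continuous_comp cf (@norm_continuous _ _ _)). Qed.
Lemma cont_Re : {for x, continuous (fun y => complex.Re (f y))}.
Proof. exact: (continuous_comp cf (@Re_continuous _ _)). Qed.
Lemma cont_Im : {for x, continuous (fun y => complex.Im (f y))}.
Proof. exact: (continuous_comp cf (@Im_continuous _ _)). Qed.
End ccont.

(** The norm of [R[i]] takes its values in [R[i]]; estimates are made with this modulus in the
    ordered field [R]. *)
Definition cabs (R : realType) (z : R[i]) : R :=
  Num.sqrt (complex.Re z ^+ 2 + complex.Im z ^+ 2).

Lemma cabsE (R : realType) (z : R[i]) : `|z| = (cabs z)%:C.
Proof. exact: normc_def. Qed.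

Lemma Re_norm (R : realType) (z : R[i]) : complex.Re `|z| = cabs z.
Proof. by rewrite cabsE. Qed.

Lemma cabs_ge0 (R : realType) (z : R[i]) : 0 <= cabs z.
Proof. exact: sqrtr_ge0. Qed.

Lemma cabs_gt0 (R : realType) (z : R[i]) : (0 < cabs z) = (z != 0).
Proof. by rewrite -ltcR -cabsE normr_gt0. Qed.

Lemma cabsM (R : realType) (z w : R[i]) : cabs (z * w) = cabs z * cabs w.
Proof. by have := normrM z w; rewrite !cabsE -rmorphM => /complexI. Qed.

Lemma cabsV (R : realType) (z : R[i]) : cabs z^-1 = (cabs z)^-1.
Proof. by have := normfV z; rewrite !cabsE -fmorphV => /complexI. Qed.

Lemma cabsN (R : realType) (z : R[i]) : cabs (- z) = cabs z.
Proof. by have := normrN z; rewrite !cabsE => /complexI. Qed.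

Lemma cabsC (R : realType) (z w : R[i]) : cabs (z - w) = cabs (w - z).
Proof. by rewrite -cabsN opprB. Qed.

Lemma cabs_real (R : realType) (x : R) : cabs x%:C = `|x|.
Proof. by rewrite /cabs /= expr0n addr0 sqrtr_sqr. Qed.

Lemma cabs0 (R : realType) : cabs (0 : R[i]) = 0.
Proof. by rewrite -[0](rmorph0 (real_complex R)) cabs_real normr0. Qed.

Lemma cabs_sqr (R : realType) (z : R[i]) :
  cabs z ^+ 2 = complex.Re z ^+ 2 + complex.Im z ^+ 2.
Proof. by rewrite sqr_sqrtr // addr_ge0 // sqr_ge0. Qed.

Lemma cabsD (R : realType) (z w : R[i]) : cabs (z + w) <= cabs z + cabs w.
Proof. by rewrite -lecR rmorphD /= -!cabsE ler_normD. Qed.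

Lemma cabs_tri (R : realType) (z w v : R[i]) :
  cabs (z - v) <= cabs (z - w) + cabs (w - v).
Proof. by rewrite -[z - v](subrKA w) cabsD. Qed.

Lemma Re_le_cabs (R : realType) (z : R[i]) : `|complex.Re z| <= cabs z.
Proof. by rewrite -lecR -cabsE normc_ge_Re. Qed.

Lemma Im_le_cabs (R : realType) (z : R[i]) : `|complex.Im z| <= cabs z.
Proof.
rewrite -sqrtr_sqr /cabs ler_wsqrtr // lerDr; exact: sqr_ge0.
Qed.

Lemma cabs_le (R : realType) (z : R[i]) :
  cabs z <= `|complex.Re z| + `|complex.Im z|.
Proof.
rewrite -(@ler_pXn2r _ 2) ?nnegrE ?cabs_ge0 ?addr_ge0 //.
rewrite cabs_sqr sqrrD !real_normK ?num_real // -addrA lerD2l lerDr.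
by rewrite mulrn_wge0 // mulr_ge0.
Qed.

Lemma diskE (R : realType) (z : R[i]) : disk z = (cabs z < 1).
Proof. by rewrite /disk /= cabsE -ltcR. Qed.

Lemma norm1E (R : realType) (z : R[i]) : (`|z| = 1) = (cabs z = 1).
Proof. by rewrite cabsE; apply/propext; split => [[]|->]. Qed.

Lemma cabs_expi (R : realType) (x : R) : cabs (expi x) = 1.
Proof. by rewrite -norm1E norm_expi. Qed.

Lemma cont_cabs (R : realType) (T : topologicalType) (f : T -> R[i]) x :
  {for x, continuous f} -> {for x, continuous (fun y => cabs (f y))}.
Proof.
move=> cf; rewrite (_ : (fun y => cabs (f y)) = fun y => complex.Re `|f y|).
  by apply: cont_Re; exact: ccont_norm.
by apply/funext => y; rewrite Re_norm.
Qed.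

Lemma nbhs_cabsP (R : realType) (z : R[i]) (A : set R[i]) :
  nbhs z A <-> exists2 e : R, 0 < e & forall w, cabs (z - w) < e -> A w.
Proof.
rewrite nbhs_complexP; split=> -[e e0 H]; exists e => // w.
  by rewrite -ltcR -cabsE; exact: H.
by rewrite cabsE ltcR; exact: H.
Qed.

Lemma cvg_cabsP (R : realType) (T : Type) (F : set_system T)
    (FF : Filter F) (g : T -> R[i]) (l : R[i]) :
  g @ F --> l <-> forall e : R, 0 < e -> \forall x \near F, cabs (l - g x) < e.
Proof.
rewrite cvg_complexP; split=> H e e0; move: (H e e0);
by apply: filterS => x; rewrite cabsE ltcR.
Qed.

Lemma closed_cabs_le (R : realType) (c : R[i]) (r : R) :
  closed [set z : R[i] | cabs (z - c) <= r].
Proof.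
rewrite -openC openE => z /= /negP; rewrite -ltNge => zr; apply/nbhs_cabsP;
  exists (cabs (z - c) - r).
  by rewrite subr_gt0.
move=> w zw /=; apply/negP; rewrite -ltNge.
have := cabs_tri z w c; lra.
Qed.

Lemma open_cabs_lt (R : realType) (c : R[i]) (r : R) :
  open [set z : R[i] | cabs (z - c) < r].
Proof.
rewrite openE => z /= zr; apply/nbhs_cabsP; exists (r - cabs (z - c)).
  by rewrite subr_gt0.
by move=> w zw; apply: le_lt_trans (cabs_tri w z c) _; rewrite cabsC -ltrBrDr.
Qed.

Lemma compact_cabs_le (R : realType) (c : R[i]) (r : R) :
  compact [set z : R[i] | cabs (z - c) <= r].
Proof.
have cs : compact ((fun p : R * R => p.1 +i* p.2 : R[i]) @`
    (`[complex.Re c - r, complex.Re c + r] `*` `[complex.Im c - r, complex.Im c +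
      r])).
  apply: continuous_compact.
    exact/continuous_subspaceT/Complex_continuous.
  by apply: compact_setX; exact: segment_compact.
apply: (subclosed_compact _ cs); first exact: closed_cabs_le.
move=> [x y] /= H.
have Hx : `|x - complex.Re c| <= r.
  apply: le_trans H; have := Re_le_cabs ((x +i* y) - c).
  by case: (c).
have Hy : `|y - complex.Im c| <= r.
  apply: le_trans H; have := Im_le_cabs ((x +i* y) - c).
  by case: (c).
move: Hx Hy; rewrite !ler_distl => Hx Hy.
by exists (x, y) => //=; split; rewrite /= in_itv.
Qed.

Lemma complex_hausdorff (R : realType) : hausdorff_space R[i].
Proof. exact: norm_hausdorff. Qed.

Lemma rcont_cst (R : realType) (T : topologicalType) (x : T) (c : R) :
  {for x, continuous (fun _ : T => c)}.
Proof. by move=> A; exact: cvg_cst. Qed.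
Section rcont.
Context (R : realType) (T : topologicalType) (f g : T -> R) (x : T).
Hypothesis cf : {for x, continuous f}.
Hypothesis cg : {for x, continuous g}.
Lemma rcontD : {for x, continuous (fun y => f y + g y)}.
Proof. exact: (continuousD cf cg). Qed.
Lemma rcontN : {for x, continuous (fun y => - f y)}.
Proof. exact: (continuousN cf). Qed.
Lemma rcontB : {for x, continuous (fun y => f y - g y)}.
Proof. exact: (continuousB cf cg). Qed.
Lemma rcontM : {for x, continuous (fun y => f y * g y)}.
Proof. exact: (continuousM cf cg). Qed.
Lemma rcontV : f x != 0 -> {for x, continuous (fun y => (f y)^-1)}.
Proof. by move=> f0; exact: (continuousV f0 cf). Qed.
End rcont.

(** * Continuous square roots along a homotopy *)

(** Half-angle formulas for the principal branch. They are applied on the right half-plane, where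
    [s] is positive. *)
Definition psqrt (R : realType) (z : R[i]) : R[i] :=
  let s := Num.sqrt ((cabs z + complex.Re z) / 2) in
  s +i* (complex.Im z / (2 * s)).

Lemma cabs_Re_gt0 (R : realType) (z : R[i]) :
  0 < complex.Re z -> 0 < (cabs z + complex.Re z) / 2.
Proof. by have := cabs_ge0 z; lra. Qed.

Lemma mulcE (R : realType) (a b c d : R) :
  (a +i* b) * (c +i* d) = (a * c - b * d) +i* (a * d + b * c).
Proof. by []. Qed.

Lemma psqrt_sqr (R : realType) (z : R[i]) :
  0 < complex.Re z -> psqrt z ^+ 2 = z.
Proof.
move=> z0; have s0 := cabs_Re_gt0 z0.
rewrite /psqrt; set s := Num.sqrt _.
have s_gt0 : 0 < s by rewrite sqrtr_gt0.
have ss : s ^+ 2 = (cabs z + complex.Re z) / 2 by rewrite sqr_sqrtr // ltW.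
have zz := cabs_sqr z.
move: s s_gt0 ss => /= s s_gt0 ss.
case: z z0 s0 ss zz => a b /= a0 s0 ss zz.
have sn : s != 0 by rewrite gt_eqF.
rewrite expr2 mulcE; congr (_ +i* _); last by field.
rewrite -!expr2 exprMn exprVn exprMn ss.
have cz : cabs (a +i* b) + a != 0 by lra.
have -> : b ^+ 2 = (cabs (a +i* b) + a) * (cabs (a +i* b) - a).
  by rewrite -[LHS](addKr (a ^+ 2)) -zz; ring.
by field.
Qed.

Lemma Re_psqrt_gt0 (R : realType) (z : R[i]) :
  0 < complex.Re z -> 0 < complex.Re (psqrt z).
Proof. by move=> z0; rewrite /= sqrtr_gt0 cabs_Re_gt0. Qed.

Lemma Im_psqrt_lt (R : realType) (z : R[i]) :
  0 < complex.Re z -> `|complex.Im (psqrt z)| < complex.Re (psqrt z).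
Proof.
move=> z0; have := Re_psqrt_gt0 z0; have := psqrt_sqr z0.
case: (psqrt z) => x y /= E x0.
rewrite -(@ltr_pXn2r _ 2) ?nnegrE ?(ltW x0) // real_normK ?num_real //.
by move: z0; rewrite -E expr2 /= -!expr2 subr_gt0.
Qed.

Lemma psqrt_continuous (R : realType) (z : R[i]) :
  0 < complex.Re z -> {for z, continuous (@psqrt R)}.
Proof.
move=> z0; have s0 := cabs_Re_gt0 z0.
have cs : {for z, continuous (fun w : R[i] => Num.sqrt ((cabs w + complex.Re w) /
  2))}.
  apply: (@continuous_comp _ _ _ (fun w : R[i] => (cabs w + complex.Re w) / 2));
    last exact: sqrt_continuous.
  apply: rcontM; last exact: rcont_cst.
  apply: rcontD; last exact: Re_continuous.
  by apply: cont_cabs; exact: ccont_id.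
apply: continuous_Complex => //.
apply: rcontM; first exact: Im_continuous.
apply: rcontV; last by rewrite mulf_neq0 // gt_eqF // sqrtr_gt0.
by apply: rcontM => //; exact: rcont_cst.
Qed.

Lemma sqr_inj_Re_gt0 (R : realType) (z w : R[i]) :
  0 < complex.Re z -> 0 < complex.Re w -> z ^+ 2 = w ^+ 2 -> z = w.
Proof.
move=> z0 w0 /eqP; rewrite eqf_sqr => /orP[/eqP//|/eqP zw].
by move: z0; rewrite zw raddfN /= oppr_gt0 ltNge (ltW w0).
Qed.

(** By [Im_psqrt_lt] principal roots from the right half-plane have argument below pi/4 in absolute
    value, so the product of two of them has positive real part, and a root with positive real part
    is unique. *)
Lemma psqrtM (R : realType) (z w : R[i]) :
  0 < complex.Re z -> 0 < complex.Re w -> 0 < complex.Re (z * w) ->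
  psqrt (z * w) = psqrt z * psqrt w.
Proof.
move=> z0 w0 zw0; apply: sqr_inj_Re_gt0.
- exact: Re_psqrt_gt0.
- have := Im_psqrt_lt z0; have := Im_psqrt_lt w0.
  have := Re_psqrt_gt0 z0; have := Re_psqrt_gt0 w0.
  case: (psqrt z) => a b; case: (psqrt w) => c d /= c0 a0 dc ba.
  rewrite subr_gt0; apply: le_lt_trans (ler_norm _) _; rewrite normrM.
  by apply: ltr_pM.
- by rewrite exprMn !psqrt_sqr.
Qed.

Lemma Re_div_gt0 (R : realType) (a b : R[i]) :
  cabs (a - b) < cabs b -> 0 < complex.Re (a / b).
Proof.
move=> ab.
have b0 : b != 0 by rewrite -cabs_gt0 (le_lt_trans _ ab) // cabs_ge0.
have : `|complex.Re (a / b - 1)| < 1.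
  apply: le_lt_trans (Re_le_cabs _) _.
  by rewrite -(divff b0) -mulrBl cabsM cabsV ltr_pdivrMr ?cabs_gt0 ?mul1r.
by rewrite raddfB /= ltr_norml => /andP[]; lra.
Qed.

Section sqrt_homotopy.
Context (R : realType) (T : topologicalType) (H : T -> R -> R[i]).

(** The mesh [2 ^- n] is fine enough for quotients of neighbouring values of the path to stay where
    [psqrt] is available. Quantifying over all close pairs, and not only over dyadic nodes, makes
    the property pass to [n.+1]. *)
Let good (x : T) (n : nat) := forall s s' : R, 0 <= s <= 1 -> 0 <= s' <= 1 ->
  `|s - s'| <= 2 ^- n -> H x s != 0 /\ 0 < complex.Re (H x s' / H x s).

Let ratio (x : T) (n k : nat) := H x (k.+1%:R / 2 ^+ n) / H x (k%:R / 2 ^+ n).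

Let lift (x : T) (n : nat) := \prod_(k < 2 ^ n) psqrt (ratio x n k).

Let node01 (n k : nat) : (k <= 2 ^ n)%N -> 0 <= (k%:R / 2 ^+ n : R) <= 1.
Proof.
move=> kn; rewrite divr_ge0 ?ler0n ?exprn_ge0 //=.
by rewrite ler_pdivrMr ?exprn_gt0 // mul1r -natrX ler_nat.
Qed.

Let good_near (x : T) :
  (forall s, 0 <= s <= 1 ->
    H x s != 0 /\ {for (x, s), continuous (fun p => H p.1 p.2)}) ->
  exists n, \forall y \near x, good y n.
Proof.
move=> Hx.
(* The neighbourhood of [x] and the mesh are drawn from one product filter, so that a single
   compactness argument over [s] provides both. *)
pose F := filter_prod (nbhs x) \oo.
pose P (i : T * nat) (s : R) := forall s', 0 <= s' <= 1 ->
  `|s - s'| <= 2 ^- i.2 -> H i.1 s != 0 /\ 0 < complex.Re (H i.1 s' / H i.1 s).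
have : \forall i \near F, `[0, 1]%classic `<=` P i.
  apply: (compact_near_coveringP _).1; first exact: segment_compact.
  move=> s /=; rewrite in_itv /= => /Hx[Hs].
  set c := H x s => cH.
  (* Two values within a quarter of [cabs c] from [c] differ by less than half of [cabs c], while
     each has modulus above three quarters of it; this is what [Re_div_gt0] needs. *)
  have c4 : 0 < cabs c / 4 by rewrite divr_gt0 // cabs_gt0.
  have /cvg_cabsP/(_ _ c4)[[U V] /= [nU /nbhs_ballP[d /= d0 dV]] UV] := cH.
  have d2 : 0 < d / 2 by rewrite divr_gt0.
  exists (ball s (d / 2), U `*` [set n | 2 ^- n < d / 2]) => /=.
    split; first exact: nbhsx_ballx.
    exists (U, [set n | 2 ^- n < d / 2]) => //=; split => //.
    have := near_infty_natSinv_lt (PosNum d2); apply: filterS => n /= nd.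
    apply: le_lt_trans nd; rewrite lef_pV2 ?posrE ?ltr0n ?exprn_gt0 //.
    by rewrite -natrX ler_nat ltn_expl.
  move=> [t [y n]] /= [st [Uy nd]] s' s'01 ts'; rewrite /ball /= in st.
  have B1 : cabs (c - H y t) < cabs c / 4.
    apply: (UV (y, t)); split => //=; apply: dV.
    by rewrite /ball /=; apply: lt_trans st _; lra.
  have B2 : cabs (c - H y s') < cabs c / 4.
    apply: (UV (y, s')); split => //=; apply: dV; rewrite /ball /=.
    rewrite -[s - s'](subrKA t); apply: le_lt_trans (ler_normD _ _) _.
    have := le_lt_trans ts' nd; lra.
  have B3 : cabs c * (3 / 4) < cabs (H y t).
    have := cabsD (c - H y t) (H y t); rewrite subrK; lra.
  split; first by rewrite -cabs_gt0; apply: le_lt_trans B3;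
    rewrite mulr_ge0 ?cabs_ge0.
  apply: Re_div_gt0 => /=.
  have := cabs_tri (H y s') c (H y t); rewrite (cabsC (H y s') c); lra.
case=> -[U V] /= [nU [N _ NV]] UV; exists N.
move: nU; apply: filterS => y Uy s s' s01 s'01 ss'.
have := UV (y, N) (conj Uy (NV N (leqnn N))) s; apply => //.
Qed.

Let node_dist (n k : nat) : `|k%:R / 2 ^+ n - k.+1%:R / 2 ^+ n| <= 2 ^- n :> R.
Proof.
by rewrite -mulrBl -natr1 opprD addrA subrr sub0r mulN1r normrN ger0_norm //
  invr_ge0 exprn_ge0.
Qed.

Let goodS (x : T) (n : nat) : good x n -> good x n.+1.
Proof.
move=> gx s s' s01 s'01 ss'; apply: gx => //; apply: le_trans ss' _.
by rewrite lef_pV2 ?posrE ?exprn_gt0 // ler_eXn2l // ltr1n.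
Qed.

Let prod_pairs (g : nat -> R[i]) m :
  \prod_(k < m.*2) g k = \prod_(k < m) (g k.*2 * g k.*2.+1).
Proof.
elim: m => [|m IH]; first by rewrite !big_ord0.
by rewrite doubleS !big_ord_recr /= IH mulrA.
Qed.

Let node_double (n k : nat) : k.*2%:R / 2 ^+ n.+1 = k%:R / 2 ^+ n :> R.
Proof. by rewrite -muln2 natrM exprS; field; rewrite expf_neq0. Qed.

(** Halving the mesh writes each ratio as a product of two ratios, all three in the right
    half-plane, so [psqrtM] applies factor by factor. *)
Let liftS (x : T) (n : nat) : good x n -> lift x n.+1 = lift x n.
Proof.
move=> gx; rewrite /lift expnS mul2n (prod_pairs (fun k => psqrt (ratio x n.+1
  k))); apply: eq_bigr => k _.
have k1 := node01 (ltnW (ltn_ord k)); have k2 := node01 (ltn_ord k).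
have k3 : 0 <= (k.*2.+1%:R / 2 ^+ n.+1 : R) <= 1.
  by apply: node01; rewrite expnS mul2n ltn_double.
have k4 : 0 <= (k.*2%:R / 2 ^+ n.+1 : R) <= 1 by rewrite node_double.
have k5 : 0 <= (k.*2.+2%:R / 2 ^+ n.+1 : R) <= 1 by rewrite -doubleS node_double.
have E : ratio x n k = ratio x n.+1 k.*2 * ratio x n.+1 k.*2.+1.
  rewrite /ratio -doubleS !node_double [RHS]mulrC mulrA divfK //.
  by have [] := gx _ _ k3 k3; rewrite ?subrr ?normr0 ?invr_ge0 ?exprn_ge0.
rewrite E psqrtM // -?E.
- by have [] := goodS gx k4 k3 (node_dist _ _).
- by have [] := goodS gx k3 k5 (node_dist _ _).
- by have [] := gx _ _ k1 k2 (node_dist _ _).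
Qed.

Let lift_eq (x : T) (n m : nat) : good x n -> good x m -> lift x n = lift x m.
Proof.
have L p q : good x p -> lift x (q + p) = lift x p.
  move=> gp; elim: q => // q IH; rewrite addSn liftS // {IH}.
  by elim: q => // q; rewrite addSn; exact: goodS.
move=> gn gm; have [nm|/ltnW nm] := leqP n m.
  by rewrite -(subnK nm) L.
by rewrite -(subnK nm) L.
Qed.

Let lift_sqr (x : T) (n : nat) : good x n -> lift x n ^+ 2 = H x 1 / H x 0.
Proof.
move=> gx; rewrite /lift -prodrXl.
have -> : \prod_(k < 2 ^ n) psqrt (ratio x n k) ^+ 2 = \prod_(k < 2 ^ n) ratio x n k.
  apply: eq_bigr => k _; rewrite psqrt_sqr //.
  by have [] := gx _ _ (node01 (ltnW (ltn_ord k))) (node01 (ltn_ord k))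
    (node_dist _ _).
have L m : (m <= 2 ^ n)%N -> \prod_(k < m) ratio x n k = H x (m%:R / 2 ^+ n) / H x 0.
  have H0 k : (k <= 2 ^ n)%N -> H x (k%:R / 2 ^+ n) != 0.
    move=> kn; have [] := gx _ _ (node01 kn) (node01 kn) => //.
    by rewrite subrr normr0 invr_ge0 exprn_ge0.
  elim: m => [_|m IH mn]; first by have := H0 0%N isT;
    rewrite big_ord0 mul0r => ?; rewrite divff.
  rewrite big_ord_recr /= IH ?(ltnW mn) // /ratio mulrC mulrA divfK //.
  exact/H0/ltnW.
by rewrite L // natrX divff // expf_neq0.
Qed.

Let lift_continuous (x : T) (n : nat) :
  (forall s, 0 <= s <= 1 ->
    H x s != 0 /\ {for (x, s), continuous (fun p => H p.1 p.2)}) ->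
  good x n -> {for x, continuous (lift^~ n)}.
Proof.
move=> Hx gx.
have cH s : 0 <= s <= 1 -> {for x, continuous (H^~ s)}.
  move=> s01.
  apply: (@continuous_comp _ _ _ (fun y => (y, s)) (fun p => H p.1 p.2)).
    by apply: (@cvg_pair _ _ _ (nbhs x) (nbhs x) (nbhs s));
      [exact: cvg_id|exact: cvg_cst].
  exact: (Hx s s01).2.
have L m : (m <= 2 ^ n)%N -> {for x, continuous (fun y => \prod_(k < m) psqrt
  (ratio y n k))}.
  elim: m => [_|m IH mn].
    rewrite (_ : (fun _ => _) = fun=> 1); first exact: ccont_cst.
    by apply/funext => y; rewrite big_ord0.
  rewrite (_ : (fun _ => _) = fun y => \prod_(k < m) psqrt (ratio y n k) * psqrt
    (ratio y n m)); last first.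
    by apply/funext => y; rewrite big_ord_recr.
  apply: ccontM; first exact/IH/ltnW.
  have m1 := node01 (ltnW mn); have m2 := node01 mn.
  have [m0 r0] := gx _ _ m1 m2 (node_dist _ _).
  apply: (@continuous_comp _ _ _ (fun y => ratio y n m));
    last exact: psqrt_continuous.
  by apply: ccontM; [exact: cH|apply: ccontV => //; exact: cH].
exact: L.
Qed.

(* The product [lift x n] of principal square roots is eventually constant in
   [n], locally uniformly in [x]. *)
Lemma sqrt_homotopy (A : set T) :
  (forall x s, A x -> 0 <= s <= 1 ->
    H x s != 0 /\ {for (x, s), continuous (fun p => H p.1 p.2)}) ->
  exists h : T -> R[i], forall x, A x ->
    {for x, continuous h} /\ h x ^+ 2 = H x 1 / H x 0.
Proof.
(* The mesh is chosen separately for each point; [lift_eq] makes the choice immaterial, so that near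
   [x] one mesh serves all points. *)
move=> HA; exists (fun x => lift x (xget 0%N [set n | good x n])) => x Ax.
have [n gn] := good_near (fun s => HA x s Ax).
have gx := nbhs_singleton gn.
have E y : good y n -> lift y (xget 0%N [set n | good y n]) = lift y n.
  by move=> gy; apply: lift_eq => //; exact: (@xgetPex _ _ [set n |
    good y n] (ex_intro _ n gy)).
split; last by rewrite E // lift_sqr.
have := lift_continuous (fun s => HA x s Ax) gx.
rewrite /continuous_at /prop_for /= E //; apply: cvg_trans.
apply: near_eq_cvg; move: gn; apply: filterS => y gy.
by rewrite E.
Qed.
End sqrt_homotopy.

(** * Invariance of domain *)

Lemma comp_fst (T U V : topologicalType) (g : T -> V) (x : T) (y : U) :
  {for x, continuous g} -> {for (x, y), continuous (fun p : T * U => g p.1)}.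
Proof. by move=> cg; exact: (@continuous_comp _ _ _ fst g (x, y) cvg_fst cg). Qed.

Lemma comp_snd (T U V : topologicalType) (g : U -> V) (x : T) (y : U) :
  {for y, continuous g} -> {for (x, y), continuous (fun p : T * U => g p.2)}.
Proof. by move=> cg; exact: (@continuous_comp _ _ _ snd g (x, y) cvg_snd cg). Qed.

(* The quotient h(-z) / h(z) squares to -1, so its imaginary part never vanishes
   on the circle, but it changes sign under z |-> -z. *)
Lemma odd_no_sqrt (R : realType) (g h : R[i] -> R[i]) :
  (forall z, cabs z = 1 ->
    [/\ {for z, continuous h}, h z ^+ 2 = g z, g z != 0 & g (- z) = - g z]) ->
  False.
Proof.
move=> H; pose q (t : R) := h (- expi t) / h (expi t).
have n1 (t : R) : cabs (expi t) = 1 := cabs_expi t.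
have n2 (t : R) : cabs (- expi t) = 1 by rewrite cabsN.
have h0 z : cabs z = 1 -> h z != 0.
  by move=> /H[_ hz gz _]; apply: contraNneq gz => h0; rewrite -hz h0 expr0n.
have qq t : q t ^+ 2 = -1.
  have [_ E1 g0 E2] := H _ (n1 t); have [_ E3 _ _] := H _ (n2 t).
  by rewrite exprMn exprVn E1 E3 E2 mulNr divff.
have q0 t : complex.Im (q t) != 0.
  apply/eqP => qt; have := qq t; case: (q t) qt => x y /= ->.
  rewrite expr2 mulcE => -[]; rewrite mul0r subr0 -expr2 => x1 _.
  by have := sqr_ge0 x; rewrite x1; lra.
(* Half a turn swaps numerator and denominator, and the inverse of a square root of -1 is its
   opposite. *)
have qpi : q pi = - q 0.
  have -> : q pi = (q 0)^-1.
    rewrite /q invf_div; congr (h _ / h _).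
      by rewrite /expi cospi sinpi cos0 sin0; congr Complex; rewrite ?opprK ?oppr0.
    by rewrite /expi cospi sinpi cos0 sin0; congr Complex; rewrite ?opprK ?oppr0.
  have q00 : q 0 != 0 by apply: contraNneq (q0 0) => ->.
  by apply: (mulIf q00); rewrite mulVf // mulNr -expr2 qq opprK.
have cq t : {for t, continuous q}.
  apply: ccontM.
    apply: (@continuous_comp _ _ _ (fun t => - expi t));
      last by have [] := H _ (n2 t).
    by apply: ccontN; exact: expi_continuous.
  apply: ccontV; last exact: h0.
  apply: continuous_comp; first exact: expi_continuous.
  by have [] := H _ (n1 t).
have cI : {within `[0, pi], continuous (fun t => complex.Im (q t))}.
  by apply: continuous_subspaceT => t; exact: cont_Im.
have [|t _ E] := @IVT R _ 0 pi 0 (pi_ge0 R) cI; last by have := q0 t; rewrite E eqxx.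
rewrite qpi raddfN /= ge_min le_max.
by case: (leP (complex.Im (q 0)) 0) => Hq /=; rewrite ?oppr_le0 ?oppr_ge0 ?Hq
  ?(ltW Hq) ?orbT.
Qed.

Lemma continuous_within (T U : topologicalType) (A : set T) (g : T -> U) :
  (forall x, A x -> {for x, continuous g}) -> {within A, continuous g}.
Proof. by move=> H; apply: continuous_in_subspaceT => x /set_mem; exact: H. Qed.

(* For q close to G(w) but outside the image of the disk, G - q has a square root on
   the circle (contract the disk), hence so do G - G(w) and, by injectivity and a
   homotopy, z |-> G(w + z/2) - G(w - z/2), which is odd. *)
Lemma injective_open (R : realType) (G : R[i] -> R[i]) (w : R[i]) (r : R) :
  0 < r ->
  (forall z, cabs (z - w) <= r -> {for z, continuous G}) ->
  set_inj [set z | cabs (z - w) <= r] G ->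
  nbhs (G w) (G @` [set z | cabs (z - w) <= r]).
Proof.
move=> r0 cG iG.
pose E (z : R[i]) := G (w + r%:C * z).
have Ew z : cabs z <= 1 -> cabs (w + r%:C * z - w) <= r.
  by move=> z1; rewrite addrAC subrr add0r cabsM cabs_real gtr0_norm // ger_pMr.
have cE z : cabs z <= 1 -> {for z, continuous E}.
  move=> z1; apply: (@continuous_comp _ _ _ (fun z => w + r%:C * z));
    last exact/cG/Ew.
  apply: ccontD; first exact: ccont_cst.
  by apply: ccontM; [exact: ccont_cst|exact: ccont_id].
have rC : r%:C != 0 :> R[i] by rewrite -cabs_gt0 cabs_real normr_gt0 gt_eqF.
have iE z z' : cabs z <= 1 -> cabs z' <= 1 -> E z = E z' -> z = z'.
  move=> z1 z'1 /iG; rewrite !inE /= => /(_ (Ew _ z1) (Ew _ z'1)) /addrI.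
  exact: mulfI.
have E0 : E 0 = G w by rewrite /E mulr0 addr0.
pose S := [set z : R[i] | cabs z = 1].
have clE : closed (E @` S).
  apply: compact_closed; first exact: complex_hausdorff.
  apply: continuous_compact.
    by apply: continuous_within => z z1; apply: cE; rewrite z1.
  apply: (subclosed_compact _ (@compact_cabs_le R 0 1)); last by move=> z /=;
    rewrite subr0 => ->.
  rewrite (_ : S = [set z | cabs (z - 0) <= 1] `&` ~` [set z | cabs (z - 0) < 1]).
    apply: closedI; first exact: closed_cabs_le.
    by apply: open_closedC; exact: open_cabs_lt.
  by apply/seteqP; split => z /=; rewrite !subr0; [move=> ->; rewrite ltxx lexx |
    case=> z1 /negP; rewrite -leNgt => ?; apply/le_anti/andP].
have nE : ~ (E @` S) (G w).
  move=> [z z1]; rewrite -E0 => /iE H.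
  have z0 : z = 0 by apply: H; rewrite ?cabs0 ?z1.
  by move: z1; rewrite z0 /S /= cabs0 => /eqP; rewrite eq_sym oner_eq0.
have /nbhs_cabsP[d d0 dE] : nbhs (G w) (~` (E @` S)).
  by apply: open_nbhs_nbhs; split => //; exact: closed_openC.
apply/nbhs_cabsP; exists d => // q qd; apply: contrapT => nq.
have Eq z : cabs z <= 1 -> E z != q.
  by move=> z1; apply/eqP => zq; apply: nq; exists (w + r%:C * z) => //; exact: Ew.
have cs (z : R[i]) (s : R) (a : R -> R) :
    {for s, continuous a} -> cabs z = 1 -> `|a s| <= 1 ->
    {for (z, s), continuous (fun p : R[i] * R => E ((a p.2)%:C * p.1))}.
  move=> ca z1 as1.
  apply: (@continuous_comp _ _ _ (fun p : R[i] * R => (a p.2)%:C * p.1)); last first.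
    by apply: cE; rewrite /= cabsM cabs_real z1 mulr1.
  apply: ccontM; last exact: cvg_fst.
  apply: (@continuous_comp _ _ _ (fun p : R[i] * R => a p.2));
    last exact: realC_continuous.
  exact: comp_snd.
(* Contraction of the disk, whose image misses [q]: [k1] is a root of [(E z - q) / (G w - q)]. *)
have [|k1 k1P] := @sqrt_homotopy R R[i] (fun z s => E (s%:C * z) - q) S.
  move=> z s z1 /andP[s0 s1]; split.
    by rewrite subr_eq0 Eq // cabsM z1 mulr1 cabs_real ger0_norm.
  apply: ccontB; last exact: ccont_cst.
  by apply: (cs z s id) => //; rewrite ?ger0_norm // => A.
(* Moving [q] to [G w] along a segment, which stays within [d] of [G w] and hence off the image of
   the circle: [k2] is a root of [(E z - G w) / (E z - q)]. *)
have [|k2 k2P] := @sqrt_homotopy R R[i] (fun z s => E z - (q + s%:C * (G w - q))) S.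
  move=> z s z1 /andP[s0 s1]; split.
    rewrite subr_eq0; apply/eqP => Ez; apply: (dE (q + s%:C * (G w - q)));
      last by exists z.
    rewrite (_ : _ - _ = (1 - s)%:C * (G w - q));
      last by rewrite rmorphB rmorph1; ring.
    rewrite cabsM cabs_real ger0_norm ?subr_ge0 //.
    by apply: le_lt_trans qd; apply: ler_piMl; [exact: cabs_ge0|lra].
  apply: ccontB.
    by apply: comp_fst; apply: cE; rewrite z1.
  apply: ccontD; first exact: ccont_cst.
  apply: ccontM; last exact: ccont_cst.
  exact: (@comp_snd R[i] R R[i] (fun s => s%:C) z s (@realC_continuous R s)).
(* The two arguments of [E] always differ by [z], so injectivity keeps the difference nonzero. It
   runs from [E z - E 0] at [s = 0] to the odd map [E (z / 2) - E (- z / 2)] at [s = 1]. *)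
have [|k3 k3P] := @sqrt_homotopy R R[i]
    (fun z s => E ((1 + s)^-1%:C * z) - E ((- s / (1 + s))%:C * z)) S.
  move=> z s z1 /andP[s0 s1].
  have s10 : 0 < 1 + s by lra.
  have B1 : `|(1 + s)^-1| <= 1 by rewrite gtr0_norm ?invr_gt0 // invf_le1 //; lra.
  have B2 : `|- s / (1 + s)| <= 1.
    by rewrite normrM normrN normfV !ger0_norm ?(ltW s10) // ler_pdivrMr //
      mul1r; lra.
  have cV : {for s, continuous (fun s : R => (1 + s)^-1)}.
    apply: rcontV; last by rewrite gt_eqF.
    by apply: rcontD; [exact: rcont_cst|move=> A].
  split.
    rewrite subr_eq0; apply/eqP => /iE; rewrite !cabsM !cabs_real z1 !mulr1 =>
      /(_ B1 B2).
    have z0 : z != 0 by rewrite -cabs_gt0 z1.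
    move=> /(mulIf z0) /complexI /(congr1 ( *%R^~ (1 + s))).
    by rewrite mulVf ?divfK ?gt_eqF //; lra.
  apply: ccontB; first exact: (cs z s (fun s => (1 + s)^-1)).
  apply: (cs z s (fun s => - s / (1 + s))) => //.
  by apply: rcontM => //; apply: rcontN => A.
(* The three quotients telescope; the constant cancels the remaining denominator [G w - q]. *)
pose k z := sqrtc (G w - q) * (k1 z * k2 z * k3 z).
apply: (@odd_no_sqrt R (fun z => E (2^-1 * z) - E (2^-1 * (- z))) k) => z z1.
have [[c1 e1] [c2 e2] [c3 e3]] := And3 (k1P z z1) (k2P z z1) (k3P z z1).
have h2 : ((1 + 1)^-1)%:C = 2^-1 :> R[i] by rewrite fmorphV rmorphD rmorph1.
split.
- apply: ccontM; first exact: ccont_cst.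
  exact: (ccontM (ccontM c1 c2) c3).
- rewrite /k !exprMn sqr_sqrtc e1 e2 e3.
  rewrite !(rmorph1, rmorph0, mul1r, mul0r, addr0, oppr0, invr1, mulr0).
  rewrite E0 !h2.
  have n1 : E z - q != 0 by rewrite subr_eq0 Eq ?z1.
  have n2 : G w - q != 0 by rewrite subr_eq0 -E0 Eq ?cabs0.
  have n3 : E z - G w != 0 by rewrite subr_eq0; apply/eqP => Ez; apply: nE; exists z.
  have -> : (-1 / (1 + 1))%:C = - 2^-1 :> R[i] by rewrite mulN1r rmorphN;
    congr (- _); exact: h2.
  have -> : q + (G w - q) = G w by ring.
  rewrite mulNr mulrN; field.
  by rewrite n1 n2 n3.
- rewrite subr_eq0; apply/eqP => /iE.
  have B : cabs (2^-1 : R[i]) <= 1.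
    by rewrite -h2 cabs_real ger0_norm ?invr_ge0 // invf_le1 //; lra.
  rewrite !cabsM cabsN z1 !mulr1 mulrN => /(_ B B) /eqP.
  rewrite -subr_eq0 opprK -mulr2n mulrn_eq0 /= mulf_eq0 invr_eq0 pnatr_eq0 /=.
  by rewrite -normr_eq0 cabsE z1 rmorph1 oner_eq0.
- by rewrite opprK opprB.
Qed.

Lemma continuous_eq_near (T U : topologicalType) (g k : T -> U) (x : T) :
  (\forall y \near x, k y = g y) -> {for x, continuous g} -> {for x, continuous k}.
Proof.
move=> E cg A; rewrite (nbhs_singleton E) => /cg H.
by apply: (filterS2 _ _ E H) => y /= Ey; rewrite /= Ey.
Qed.

(** * Bijections of the disk *)

Lemma derivable_complex_continuous (R : realType) (g : R[i] -> R[i]) (z : R[i]) :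
  derivable g z 1 -> {for z, continuous g}.
Proof. by move=> /derivable1_diffP; exact: differentiable_continuous. Qed.

Section disk_bijection.
Context (R : realType) (G : R[i] -> R[i]) (U : set R[i]).
Hypothesis cG : forall z, disk z -> {for z, continuous G}.
Hypothesis bG : set_bij (@disk R) U G.
Let inv := 'pinv_(fun=> 0) (@disk R) G.

Lemma disk_pinv y : U y -> disk (inv y).
Proof. by case: (bijpinv_bij (fun=> 0) bG) => H _ _; exact: H. Qed.

Lemma disk_pinvK y : U y -> G (inv y) = y.
Proof. by move=> Uy; case: bG => _ _ sG; apply: (surjpK _ sG); rewrite inE. Qed.

Lemma disk_pinvKV z : disk z -> inv (G z) = z.
Proof. by move=> dz; case: bG => _ iG _; apply: (pinvKV _ iG); rewrite inE. Qed.

Lemma disk_image_nbhs z A : nbhs z A -> disk z -> nbhs (G z) (G @` (A `&` @disk R)).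
Proof.
move=> /nbhs_cabsP[e e0 eA] dz; move: (dz); rewrite diskE => z1.
pose r := Num.min (e / 2) ((1 - cabs z) / 2).
have r0 : 0 < r by rewrite lt_min !divr_gt0 // subr_gt0.
have rP w : cabs (w - z) <= r -> (A `&` @disk R) w.
  rewrite le_min => /andP[we w1]; split.
    by apply: eA; rewrite cabsC; apply: le_lt_trans we _;
      rewrite ltr_pdivrMr // ltr_pMr // ltr1n.
  by rewrite diskE; have := cabsD (w - z) z; rewrite subrK; lra.
have := @injective_open R G z r r0.
move=> /(_ (fun w wr => cG (rP w wr).2)) => H.
apply: (@filterS _ (nbhs (G z)) _ (G @` [set w | cabs (w - z) <= r])).
  by move=> _ [w wr <-]; exists w => //; exact: rP.
apply: H; case: bG => _ iG _ w w'; rewrite !inE => wr w'r.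
by apply: iG; rewrite inE; [exact: (rP _ wr).2|exact: (rP _ w'r).2].
Qed.

Lemma disk_pinv_continuous y : U y -> {for y, continuous inv}.
Proof.
move=> Uy A nA.
have := disk_image_nbhs nA (disk_pinv Uy); rewrite disk_pinvK //.
apply: (@filterS _ (nbhs y)) => _ [z [Az dz] <-].
by rewrite /= disk_pinvKV.
Qed.

(** Radial contraction of the disk joins [G - a] to the constant [G 0 - a] without meeting 0; the
    resulting root on the disk is carried to [U] by the continuous inverse. *)
Lemma sqrt_on_disk_image a : ~ U a ->
  exists h : R[i] -> R[i], forall y, U y -> {for y, continuous h} /\ h y ^+ 2 = y - a.
Proof.
move=> Ua; have [fG iG sG] := bG.
have Ga z : disk z -> G z - a != 0.
  by move=> dz; rewrite subr_eq0; apply/eqP => za; apply: Ua; rewrite -za; exact: fG.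
have scale (z : R[i]) (s : R) : disk z -> 0 <= s <= 1 -> disk (s%:C * z).
  rewrite !diskE cabsM cabs_real => z1 /andP[s0 s1]; rewrite ger0_norm //.
  by apply: le_lt_trans z1; rewrite ler_piMl // cabs_ge0.
have [|k kP] := @sqrt_homotopy R R[i] (fun z s => G (s%:C * z) - a) (@disk R).
  move=> z s dz s01; have dsz := scale z s dz s01; split; first exact: Ga.
  apply: ccontB; last exact: ccont_cst.
  apply: (@continuous_comp _ _ _ (fun p : R[i] * R => p.2%:C * p.1)); last exact: cG.
  apply: ccontM; last exact: cvg_fst.
  exact: (@comp_snd R[i] R R[i] (fun s => s%:C) z s (@realC_continuous R s)).
exists (fun y => sqrtc (G 0 - a) * k (inv y)) => y Uy.
have dy := disk_pinv Uy; have [ck ek] := kP _ dy; split.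
  apply: ccontM; first exact: ccont_cst.
  by apply: (@continuous_comp _ _ _ inv); [exact: disk_pinv_continuous|].
rewrite exprMn sqr_sqrtc ek rmorph1 mul1r rmorph0 mul0r disk_pinvK // mulrC divfK //.
by apply: Ga; rewrite /disk /= normr0.
Qed.
End disk_bijection.

(** * Separation of the plane by closed curves *)

Lemma avoid_near (R : realType) (eta : R -> R[i]) (a b : R) (z : R[i]) :
  (forall s, a <= s <= b -> {for s, continuous eta}) ->
  (forall s, a <= s <= b -> z * eta s != 1) ->
  \forall w \near z, forall s, a <= s <= b -> w * eta s != 1.
Proof.
move=> ce Hz.
have := (compact_near_coveringP _).1 (@segment_compact R a b) R[i] (nbhs z)
  (fun w s => w * eta s != 1) _.
move=> H; have {}H : \forall w \near nbhs z, `[a, b]%classic `<=` (fun s => w *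
  eta s != 1).
  apply: H => s /=; rewrite in_itv /= => sab.
  have c : {for (s, z), continuous (fun p : R * R[i] => p.2 * eta p.1 - 1)}.
    apply: ccontB; last exact: ccont_cst.
    by apply: ccontM; [exact: cvg_snd|apply: comp_fst; exact: ce].
  have n0 : z * eta s - 1 != 0 by rewrite subr_eq0 Hz.
  have c0 : 0 < cabs (z * eta s - 1) by rewrite cabs_gt0.
  have /cvg_cabsP/(_ _ c0) := c.
  apply: filterS => -[t w] /= tw; apply/eqP => E; move: tw.
  by rewrite E subrr subr0 ltxx.
move: H; apply: (@filterS _ (nbhs z)) => w Hw s sab; apply: Hw.
by rewrite /= in_itv.
Qed.

(* The curve is eta = 1 / Gamma: the equation [z * eta s = 1] means that [z]
   lies on Gamma, and [eta = 0] is the point at infinity. *)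
Lemma closed_curve_separates (R : realType) (eta : R -> R[i]) (s0 : R) :
  0 < s0 <= 1 ->
  continuous eta ->
  (forall s t, 0 < s <= 1 -> 0 < t <= 1 -> eta s = eta t -> s = t) ->
  eta 0 = eta s0 -> eta 1 = 0 ->
  (forall s, 0 < s < 1 -> exists h : R[i] -> R[i], forall z,
     (forall t, s <= t <= 1 -> z * eta t != 1) ->
     {for z, continuous h} /\ h z ^+ 2 = 1 - z * eta s) ->
  ~ connected [set z | forall s, 0 <= s <= 1 -> z * eta s != 1].
Proof.
move=> /andP[s00 s01] ceta ieta eta0 eta1 sqrtH; set X := [set z | _] => cX.
pose tau := s0 / 2.
have tau0 : 0 < tau by rewrite /tau; lra.
have taus : tau < s0 by rewrite /tau; lra.
pose U s := [set z : R[i] | forall t, s <= t <= 1 -> z * eta t != 1].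
pose V := [set z : R[i] | (forall t, 0 <= t <= tau -> z * eta t != 1) /\ U s0 z].
have oU s z : U s z -> nbhs z (U s).
  by move=> Uz; exact: (avoid_near (fun t _ => ceta t) Uz).
have oV z : V z -> nbhs z V.
  by case=> Vz Uz; apply: (@filterI _ (nbhs z));
    [exact: (avoid_near (fun t _ => ceta t) Vz)|exact: oU].
have tau01 : 0 < tau < 1 by apply/andP; split=> //; lra.
have tau1 : 0 < tau <= 1 by apply/andP; split=> //; lra.
have [h1 h1P] := sqrtH tau tau01.
(* This root supplies the denominator left by the homotopy below. If [s0 = 1] the curve closes up at
   infinity, [eta 1 = 0], and the function to be rooted is the constant 1. *)
have [h0 h0P] : exists h : R[i] -> R[i], forall z, U s0 z ->
     {for z, continuous h} /\ h z ^+ 2 = 1 - z * eta s0.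
  have [s1|s1] := ltP s0 1; first by apply: sqrtH; rewrite s00.
  exists (fun=> 1) => z Uz; split; first exact: ccont_cst.
  by rewrite (_ : s0 = 1) ?eta1 ?mulr0 ?subr0 ?expr1n //; lra.
(* Sliding from [eta 0] to [eta tau] gives a root of [(1 - z * eta tau) / (1 - z * eta 0)]; since
   [eta 0 = eta s0], the factor [h0] clears the denominator. *)
have [|k kP] := @sqrt_homotopy R R[i] (fun z s => 1 - z * eta (tau * s)) V.
  move=> z s [Vz _] /andP[t0 t1]; split.
    rewrite subr_eq0 eq_sym; apply: Vz.
    by rewrite mulr_ge0 ?(ltW tau0) //= ger_pMr.
  apply: ccontB; first exact: ccont_cst.
  apply: ccontM; first exact: cvg_fst.
  apply: (@comp_snd R[i] R R[i] (fun s => eta (tau * s)) z s).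
  apply: (@continuous_comp _ _ _ (fun s => tau * s)); last exact: ceta.
  by apply: rcontM; [exact: rcont_cst|move=> A].
pose h2 (z : R[i]) : R[i] := k z * h0 z.
have h2P z : V z -> {for z, continuous h2} /\ h2 z ^+ 2 = 1 - z * eta tau.
  move=> Vz; have [c e] := kP z Vz; have [c' e'] := h0P z Vz.2; split.
    exact: (ccontM c c').
  rewrite exprMn e e' mulr1 mulr0 eta0 divfK // subr_eq0 eq_sym.
  by apply: Vz.2; rewrite lexx.
have XU z : X z -> U tau z by move=> Xz t tt; apply: Xz; lra.
have XV z : X z -> V z.
  by move=> Xz; split=> t tt; apply: Xz; lra.
have UVX z : U tau z -> V z -> X z.
  move=> Uz [Vz _] t /andP[t0 t1]; have [tt|tt] := leP t tau.
    by apply: Vz; rewrite t0.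
  by apply: Uz; rewrite (ltW tt).
have ntau z : X z -> 1 - z * eta tau != 0.
  by move=> Xz; rewrite subr_eq0 eq_sym; apply: (XU z Xz); rewrite lexx /=; lra.
(* On [X] the two roots have the same square, so their quotient is 1 or -1 at each point;
   connectedness prevents both values from occurring. *)
have [e e1 eP] : exists2 e : R[i], e ^+ 2 = 1 & forall z, X z -> h1 z = e * h2 z.
  pose q z := h1 z / h2 z.
  have h20 z : X z -> h2 z != 0.
    move=> Xz; have [_ E] := h2P z (XV z Xz); apply: contraNneq (ntau z Xz).
    by move=> h; rewrite -E h expr0n.
  have cq : {within X, continuous (fun z => complex.Re (q z))}.
    apply: continuous_within => z Xz; apply: cont_Re.
    have [c _] := h1P z (XU z Xz); have [c' _] := h2P z (XV z Xz).
    exact: (ccontM c (ccontV c' (h20 z Xz))).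
  have q1 z : X z -> q z = 1 \/ q z = -1.
    move=> Xz; suff /eqP : q z ^+ 2 = 1 ^+ 2.
      by rewrite eqf_sqr => /orP[] /eqP; [left|right].
    rewrite expr1n /q exprMn exprVn.
    have [_ ->] := h1P z (XU z Xz); have [_ ->] := h2P z (XV z Xz).
    by rewrite divff // ntau.
  have /connected_intervalP iq := connected_continuous_connected cX cq.
  have [[z0 [X0 q0]]|nq] := pselect (exists z, X z /\ q z = 1).
    exists 1; first by rewrite expr1n.
    move=> z Xz; have [qz|qz] := q1 z Xz.
      by apply: (mulIf (invr_neq0 (h20 z Xz))); rewrite mul1r divff ?h20.
    have I1 : [set complex.Re (q z) | z in X] (-1) by exists z => //; rewrite qz.
    have I2 : [set complex.Re (q z) | z in X] 1 by exists z0 => //; rewrite q0.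
    have [|w Xw qw] := iq _ _ I1 I2 0; first by rewrite lerN10 ler01.
    by have [Q|Q] := q1 w Xw; move: qw; rewrite Q /= => /eqP;
      rewrite ?oppr_eq0 oner_eq0.
  exists (-1); first by rewrite sqrrN expr1n.
  move=> z Xz; have [qz|qz] := q1 z Xz; first by exfalso; apply: nq; exists z.
  by apply: (mulIf (invr_neq0 (h20 z Xz))); rewrite mulfK ?h20.
pose h z := if pselect (U tau z) then h1 z else e * h2 z.
have hP z : U tau z \/ V z -> {for z, continuous h} /\ h z ^+ 2 = 1 - z * eta tau.
  have hU w : U tau w -> h w = h1 w by rewrite /h; case: pselect.
  have hV w : V w -> h w = e * h2 w.
    by rewrite /h; case: pselect => // Uw Vw; apply: eP; exact: UVX.
  case=> Hz.
    have [c E] := h1P z Hz; split; last by rewrite hU.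
    apply: continuous_eq_near c; move: (oU _ _ Hz).
    exact: (@filterS _ (nbhs z)).
  have [c E] := h2P z Hz; split; last by rewrite hV // exprMn e1 mul1r.
  have c2 : {for z, continuous (fun w : R[i] => e * h2 w : R[i])}.
    exact: (ccontM (@ccont_cst _ _ z e) c).
  apply: continuous_eq_near c2; move: (oV _ Hz).
  exact: (@filterS _ (nbhs z)).
have et0 : eta tau != 0.
  by apply/eqP; rewrite -eta1 => /ieta H; have := H tau1;
    rewrite ltr01 lexx => /(_ isT); lra.
pose a := (eta tau)^-1.
have aet : a * eta tau = 1 by rewrite mulVf.
have : nbhs a (U s0).
  apply: oU => t tt; apply/eqP => at1.
  have : eta tau = eta t.
    by apply: (mulfI (invr_neq0 et0)); rewrite mulVf.
  by move=> /ieta H; have := H tau1; lra.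
move=> /nbhs_cabsP[d d0 dU].
(* A point in neither set would be on the curve at some [t >= tau] and at some [t' <= tau]. If
   [t' > 0], injectivity gives [t = t' = tau], which is the centre [a]; the value [t' = 0] is
   excluded by [dU], because [eta 0 = eta s0]. *)
have ball_UV z : cabs (z - a) < d -> z != a -> U tau z \/ V z.
  move=> zd za; have [Uz|nU] := pselect (U tau z); [by left|right].
  move: nU => /existsNP[t] /not_implyP[tt /negP]; rewrite negbK => /eqP zt.
  split; last by apply: dU; rewrite cabsC.
  move=> t' tt'; apply/eqP => zt'.
  have z0 : z != 0 by apply/eqP => z0; move: zt; rewrite z0 mul0r => /eqP;
    rewrite eq_sym oner_eq0.
  have ett : eta t = eta t' by apply: (mulfI z0); rewrite zt zt'.
  have [t'0|t'0] := eqVneq t' 0.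
    have /negP[] : z * eta s0 != 1.
      by apply: dU; [rewrite cabsC|rewrite lexx].
    by rewrite -eta0 -t'0 zt'.
  have t'p : 0 < t' by rewrite lt_neqAle eq_sym t'0; lra.
  have tE : t = t' by apply: ieta => //; lra.
  have tE' : t = tau by move: tt tt'; rewrite tE; lra.
  move/eqP: za; apply; apply: (mulIf et0).
  by rewrite aet -tE' zt.
pose r := d / 2.
have r0 : 0 < r by rewrite /r; lra.
(* Since [a * eta tau = 1], the function [1 - v * eta tau] at [v = a + r * z] is linear and odd in
   [z]. *)
apply: (@odd_no_sqrt R (fun z => - (r%:C * z) * eta tau) (fun z => h (a + r%:C *
  z))) => z z1.
have za : a + r%:C * z != a.
  rewrite -subr_eq0 addrAC subrr add0r -cabs_gt0 cabsM z1 mulr1 cabs_real normr_gt0.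
  by rewrite gt_eqF.
have [c E] : {for a + r%:C * z, continuous h} /\ h (a + r%:C * z) ^+ 2 = 1 - (a +
  r%:C * z) * eta tau.
  apply: hP; apply: ball_UV => //.
  rewrite addrAC subrr add0r cabsM z1 mulr1 cabs_real gtr0_norm //.
  by rewrite /r; lra.
split.
- apply: (@continuous_comp _ _ _ (fun z => a + r%:C * z)); last exact: c.
  apply: ccontD; first exact: ccont_cst.
  by apply: ccontM; [exact: ccont_cst|exact: ccont_id].
- by rewrite E mulrDl aet; ring.
- rewrite mulf_neq0 // oppr_eq0 mulf_neq0 //.
    by rewrite -cabs_gt0 cabs_real normr_gt0 gt_eqF.
  by rewrite -cabs_gt0 z1.
- by ring.
Qed.

(** * Arcs and area *)

(** By compactness, parameters at distance at least [e] from [s0] give points that keep a positive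
    distance from [g s0]. The neighbourhood is one of the plane: points off the arc satisfy the
    condition vacuously. *)
Lemma arc_inverse_near (R : realType) (g : R -> R[i]) (s0 e : R) :
  {within `[0, 1], continuous g} ->
  set_inj `[0, 1] g -> 0 <= s0 <= 1 -> 0 < e ->
  \forall z \near g s0, forall s, 0 <= s <= 1 -> g s = z -> `|s0 - s| < e.
Proof.
move=> /subspace_continuousP cg ig s01 e0.
have H := (@near_covering_withinP _ _).2
  ((compact_near_coveringP _).1 (@segment_compact R 0 1)) R[i] (nbhs (g s0))
  (fun z s => g s = z -> `|s0 - s| < e) _.
have {}H : \forall z \near nbhs (g s0), `[0, 1]%classic `<=` (fun s => g s = z ->
  `|s0 - s| < e).
  apply: H => s /[dup] s01' /cg cgs; have [se|se] := ltP `|s0 - s| e.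
    exists ([set t | `|s0 - t| < e], setT) => /=; last by move=> [t z] /= [].
    split; last exact: filterT.
    apply/nbhs_ballP; exists (e - `|s0 - s|) => /=; first by rewrite subr_gt0.
    move=> t; rewrite /ball /= => st.
    by rewrite -[s0 - t](subrKA s) (le_lt_trans (ler_normD _ _)) // addrC -ltrBrDr.
  have ss0 : g s - g s0 != 0.
    rewrite subr_eq0; apply/eqP => /ig E; move: se; rewrite E ?subrr ?normr0 ?inE //.
    by rewrite leNgt e0.
  have d0 : 0 < cabs (g s - g s0) / 2 by rewrite divr_gt0 // cabs_gt0.
  have /cvg_cabsP/(_ _ d0) W := cgs.
  exists ([set t | `[0, 1]%classic t -> cabs (g s - g t) < cabs (g s - g s0) / 2],
     [set z | cabs (z - g s0) < cabs (g s - g s0) / 2]) => /=.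
    split; first exact: W.
    by apply: open_nbhs_nbhs; split; [exact: open_cabs_lt|rewrite /= subrr cabs0].
  move=> [t z] /= [H1 H2] t01 gt; exfalso.
  have := cabs_tri (g s) z (g s0); have := H1 t01; rewrite gt; move: H2; lra.
move: H; apply: (@filterS _ (nbhs (g s0))) => z Hz s s01'; apply: Hz.
by rewrite /= in_itv.
Qed.

(** The sets are arbitrary, so monotonicity is drawn from the supremum that defines the integral of
    a nonnegative function and from the outer measure of the sections. *)
Lemma le_product_measure (R : realType) (A B : set (R * R)) : A `<=` B ->
  (((@lebesgue_measure R) \x (@lebesgue_measure R)) A <=
   ((@lebesgue_measure R) \x (@lebesgue_measure R)) B)%E.
Proof.
move=> AB; rewrite /product_measure1 !ge0_integralTE; [|by move=> x;
  exact: measure_ge0..].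
apply: le_ereal_sup => _ [h hA <-]; exists h => // x; apply: le_trans (hA x) _.
apply: le_outer_measure => y; rewrite /xsection /= !inE; exact: AB.
Qed.

Lemma area_gt0 (R : realType) (A U : set R[i]) (c : R[i]) :
  nbhs c U -> U `<=` A -> area A != 0%E.
Proof.
move=> /nbhs_cabsP[e e0 eU] UA.
(* On a square of half side [r] the modulus is at most [2 * r], which has to be strictly below
   [e]. *)
pose r := e / 3.
have r0 : 0 < r by rewrite /r; lra.
pose I (x : R) := `[x - r, x + r]%classic.
have sub : (I (complex.Re c) `*` I (complex.Im c)) `<=` [set p | A (p.1 +i* p.2)].
  move=> [x y] []; rewrite /I /= !in_itv /= => /andP[x1 x2] /andP[y1 y2].
  apply/UA/eU; apply: le_lt_trans (cabs_le _) _.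
  have : `|complex.Re (c - (x +i* y))| <= r by rewrite ler_norml;
    case: (c) x1 x2 => a b /=; lra.
  have : `|complex.Im (c - (x +i* y))| <= r by rewrite ler_norml;
    case: (c) y1 y2 => a b /=; lra.
  by rewrite /r; lra.
apply/negP => /eqP A0; have := le_product_measure sub.
rewrite -/(area A) A0 leNgt product_measure1E; [|exact: measurable_itv..].
have LI (x : R) : (0 < (@lebesgue_measure R) (I x))%E.
  rewrite /I lebesgue_measure_itv /= lte_fin; have -> : x - r < x + r by lra.
  by rewrite -EFinD lte_fin; lra.
by move=> /negP; apply; exact: (mule_gt0 (LI _) (LI _)).
Qed.

(* A continuous real function takes equal values at two antipodal points of a
   circle, so the inverse parametrization cannot be injective on a disk. *)
Lemma slit_interior_empty (R : realType) (g : R -> R[i]) (c : R[i]) (U : set R[i]) :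
  {within `[0, 1], continuous g} -> set_inj `[0, 1] g ->
  nbhs c U -> ~ (U `<=` g @` `[0, 1]).
Proof.
move=> cg ig /nbhs_cabsP[e e0 eU] Ug.
pose r := e / 2.
have r0 : 0 < r by rewrite /r; lra.
pose inv (z : R[i]) : R := xget 0 [set s | 0 <= s <= 1 /\ g s = z].
have invP z : cabs (z - c) = r -> 0 <= inv z <= 1 /\ g (inv z) = z.
  move=> zr; have [|s s01 gs] := Ug z.
    by apply: eU; rewrite cabsC zr /r; lra.
  apply: (@xgetPex _ 0 [set s | 0 <= s <= 1 /\ g s = z]).
  by exists s; split=> //; move: s01; rewrite /= in_itv.
have Ir z : cabs z = 1 -> cabs ((c + r%:C * z) - c) = r.
  by move=> z1; rewrite addrAC subrr add0r cabsM z1 mulr1 cabs_real gtr0_norm.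
pose phi (w : R[i]) := inv (c + r%:C * w).
have cphi (p : R -> R[i]) (t : R) : (forall t, cabs (p t) = 1) ->
    {for t, continuous p} -> {for t, continuous (fun t => phi (p t))}.
  move=> p1 cp; apply/cvgrPdist_lt => d d0.
  have [i01 gi] := invP _ (Ir _ (p1 t)).
  have := arc_inverse_near cg ig i01 d0; rewrite gi => N.
  have cq : {for t, continuous (fun t => c + r%:C * p t)}.
    exact: (ccontD (@ccont_cst _ _ t c) (ccontM (@ccont_cst _ _ t r%:C) cp)).
  move: (cq _ N); apply: (@filterS _ (nbhs t)) => t' /= H.
  by have [i01' gi'] := invP _ (Ir _ (p1 t')); exact: H.
pose psi (t : R) := phi (expi t) - phi (- expi t).
have cpsi : {within `[0, pi], continuous psi}.
  apply: continuous_subspaceT => t.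
  have n1 (t' : R) : cabs (expi t') = 1 by exact: cabs_expi.
  have n2 (t' : R) : cabs (- expi t') = 1 by rewrite cabsN.
  have c2 : {for t, continuous (fun t => - expi t : R[i])} := ccontN
    (@expi_continuous R t).
  exact: (rcontB (cphi (@expi R) t n1 (@expi_continuous R t)) (cphi (fun t => -
    expi t) t n2 c2)).
have psipi : psi pi = - psi 0.
  rewrite /psi /expi cospi sinpi cos0 sin0 opprB; congr (phi _ - phi _);
    congr Complex; rewrite ?opprK ?oppr0 //.
have [|t _ E] := @IVT R psi 0 pi 0 (pi_ge0 R) cpsi.
  rewrite psipi ge_min le_max.
  by case: (leP (psi 0) 0) => Hq /=; rewrite ?oppr_le0 ?oppr_ge0 ?Hq ?(ltW Hq) ?orbT.
have n1 : cabs (expi t) = 1 by exact: cabs_expi.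
have n2 : cabs (- expi t) = 1 by rewrite cabsN.
have [_ g1] := invP _ (Ir _ n1); have [_ g2] := invP _ (Ir _ n2).
move: E => /eqP; rewrite subr_eq0 => /eqP E; rewrite /phi in E.
rewrite E g2 in g1; move: g1 => /addrI.
have rC : r%:C != 0 :> R[i] by rewrite -cabs_gt0 cabs_real normr_gt0 gt_eqF.
move=> /(mulfI rC) /eqP; rewrite eq_sym -subr_eq0 opprK -mulr2n mulrn_eq0 /=.
by rewrite -normr_eq0 cabsE n1 rmorph1 oner_eq0.
Qed.

Lemma near_invc (R : realType) (w : R[i]) (A : set R[i]) :
  w != 0 -> nbhs w^-1 A -> \forall v \near w, A v^-1.
Proof.
move=> w0 nA.
have c : {for w, continuous (fun v : R[i] => v^-1 : R[i])}.
  exact: (ccontV (@ccont_id R w) w0).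
exact: (c A nA).
Qed.

(** Tietze extension of the inverse parametrization, which is continuous on the compact arc by
    [arc_inverse_near]. Followed by [eta], it retracts the plane onto the arc. *)
Lemma arc_retraction (R : realType) (eta : R -> R[i]) :
  continuous eta -> set_inj `[0, 1] eta ->
  exists e : R[i] -> R, [/\ continuous e, forall z, 0 <= e z <= 1 &
    forall s, 0 <= s <= 1 -> e (eta s) = s].
Proof.
move=> ceta ieta.
have ceta' : {within `[0, 1], continuous eta} by exact: continuous_subspaceT.
pose K := [set p : R * R | (eta @` `[0, 1]) (p.1 +i* p.2)].
have clK : closed K.
  apply: (@preimage_closed _ _ (fun p : R * R => p.1 +i* p.2) (eta @` `[0, 1])).
    by move=> p _; exact: Complex_continuous.
  apply: compact_closed; first exact: complex_hausdorff.
  by apply: continuous_compact => //; exact: segment_compact.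
pose inv (p : R * R) : R := xget 0 [set s | 0 <= s <= 1 /\ eta s = p.1 +i* p.2].
have invP p : K p -> 0 <= inv p <= 1 /\ eta (inv p) = p.1 +i* p.2.
  move=> [s s01 gs]; apply: (@xgetPex _ 0 [set s |
    0 <= s <= 1 /\ eta s = p.1 +i* p.2]).
  by exists s; split=> //; move: s01; rewrite /= in_itv.
have cinv : {within K, continuous inv}.
  apply/subspace_continuousP => p Kp; apply/cvgrPdist_lt => d d0.
  have [i01 gi] := invP _ Kp.
  have := arc_inverse_near ceta' ieta i01 d0; rewrite gi => N.
  move: (Complex_continuous N); apply: (@filterS _ (nbhs p)) => q /= H Kq.
  by have [i01' gi'] := invP _ Kq; exact: H.
have nK : normal_space (R * R)%type by exact: (@pseudometric_normal R).
have [|e [eK ce e1]] := @continuous_bounded_extension _ R nK K clK inv 1 ltr01 cinv.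
  by move=> p /invP[/andP[p0 p1] _]; rewrite ger0_norm.
(* The extension has values in [-1, 1]; the absolute value brings them into [0, 1] and changes
   nothing on the arc. *)
exists (fun z => `|e (complex.Re z, complex.Im z)|); split.
- move=> z; apply: (@continuous_comp _ _ _ (fun z : R[i] => e (complex.Re z,
  complex.Im z))); last exact: norm_continuous.
  apply: (@continuous_comp _ _ _ (fun z : R[i] => (complex.Re z, complex.Im z)));
    last exact: ce.
  exact: (@cvg_pair _ _ _ (nbhs z) _ _ _ _ _ _ _ (@Re_continuous R z)
    (@Im_continuous R z)).
- by move=> z; rewrite normr_ge0 e1.
- move=> s s01; set p := (_, _).
  have pE : p.1 +i* p.2 = eta s by rewrite /p /=; case: (eta s).
  have Kp : K p by rewrite /K /= -/p pE; exists s => //; rewrite /= in_itv.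
  have [i01 gi] := invP _ Kp; rewrite -eK ?inE //.
  have -> : inv p = s by apply: ieta; rewrite ?inE /= ?in_itv // gi pE.
  by rewrite ger0_norm //; case/andP: s01.
Qed.

(* If [q] were separated from [Omega] by the arc, the identity outside the union
   of the separated components, glued to a retraction onto the (inverted) arc
   inside, would be a map of the plane that avoids [1 / q] and is the identity
   near infinity. *)
Lemma arc_not_separating (R : realType) (eta : R -> R[i]) (Omega : set R[i]) (q :
  R[i]) :
  continuous eta -> set_inj `[0, 1] eta -> eta 1 = 0 ->
  open Omega -> Omega 0 ->
  (forall z, closure Omega z -> Omega z \/ exists2 s, 0 <= s <= 1 & z * eta s = 1) ->
  (forall s, 0 <= s <= 1 -> q * eta s != 1) -> Omega q.
Proof.
move=> ceta ieta eta1 oO O0 clO qeta; apply: contrapT => nOq.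
have [e [ce e01 eK]] := arc_retraction ceta ieta.
have q0 : q != 0 by apply/eqP => q0; apply: nOq; rewrite q0.
(* The coordinate is [w = 1 / z]: the arc is [eta] itself, and [Omega] turns into a neighbourhood of
   infinity. *)
pose W := [set w : R[i] | w != 0 /\ ~ closure Omega w^-1].
pose r (w : R[i]) : R[i] := eta (e w).
have cr w : {for w, continuous r} by apply: (@continuous_comp _ _ _ e);
  [exact: ce|exact: ceta].
pose G (w : R[i]) : R[i] := if pselect (W w) then r w else w.
have GW w : W w -> G w = r w by rewrite /G; case: pselect.
have GN w : ~ W w -> G w = w by rewrite /G; case: pselect.
have n0 (w : R[i]) : w != 0 -> \forall v \near w, v != 0.
  move=> w0; apply/nbhs_cabsP; exists (cabs w); first by rewrite cabs_gt0.
  by move=> v wv; apply/eqP => v0; move: wv; rewrite v0 subr0 ltxx.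
have oW w : W w -> nbhs w W.
  move=> [w0 cw].
  have N : nbhs w^-1 (~` closure Omega).
    by apply: open_nbhs_nbhs; split=> //; exact/closed_openC/closed_closure.
  exact: (@filterS2 _ (nbhs w) _ _ _ _ _ (n0 _ w0) (near_invc w0 N)).
(* On the arc both formulas for [G] give [w]. Off the arc only one of them is used near [w], because
   the boundary of [Omega] lies on the arc. *)
have cG w : {for w, continuous G}.
  have [[s s01 ws]|nw] := pselect (exists2 s, 0 <= s <= 1 & eta s = w).
    have rw : r w = w by rewrite /r -ws eK.
    have Gw : G w = w by rewrite /G; case: pselect.
    apply/(@cvg_cabsP R _ (nbhs w) (nbhs_filter w) G (G w)) => d d0; rewrite Gw.
    have := (@cvg_cabsP R _ (nbhs w) (nbhs_filter w) r (r w)).1 (cr w) d d0;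
      rewrite rw => N.
    have N' : \forall v \near w, cabs (w - v) < d by apply/nbhs_cabsP; exists d.
    apply: (@filterS2 _ (nbhs w) _ _ _ _ _ N N') => v /= H1 H2.
    by rewrite /G; case: pselect.
  have [Ww|nWw] := pselect (W w).
    apply: (continuous_eq_near _ (cr w)); move: (oW _ Ww).
    exact: (@filterS _ (nbhs w)).
  have w0 : w != 0.
    by apply/eqP => w0; apply: nw; exists 1; rewrite ?ler01 ?lexx // eta1 w0.
  have Ow : Omega w^-1.
    have : closure Omega w^-1 by apply: contrapT => ?; apply: nWw.
    move=> /clO[//|[s s01 ws]]; exfalso; apply: nw; exists s => //.
    by apply: (mulfI (invr_neq0 w0)); rewrite mulVf.
  have N : nbhs w^-1 Omega by apply: open_nbhs_nbhs; split.
  apply: (continuous_eq_near _ (@ccont_id R w)).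
  move: (near_invc w0 N); apply: (@filterS _ (nbhs w)) => v /= Ov.
  by apply: GN => -[_]; apply; exact: subset_closure.
pose q' := q^-1.
have Wq : W q'.
  split; first exact: invr_neq0.
  rewrite /q' invrK => /clO[//|[s s01 qs]].
  by have := qeta s s01; rewrite qs eqxx.
have Gq w : G w != q'.
  have [Ww|nWw] := pselect (W w); last first.
    rewrite (GN _ nWw); apply/eqP => wq; apply: nWw; rewrite wq; exact: Wq.
  rewrite (GW _ Ww); apply/eqP => E; have := qeta _ (e01 w).
  by rewrite -/(r w) E /q' divff // eqxx.
have /nbhs_cabsP[d d0 dO] : nbhs (0 : R[i]) Omega by apply: open_nbhs_nbhs; split.
(* Beyond modulus [d^-1] the inverse of a point is in [Omega], so [G] is the identity there; the
   summand [cabs q'] keeps the segment from [q'] to 0 inside the circle of radius [M]. *)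
pose M := d^-1 + cabs q' + 1.
have dV : 0 < d^-1 by rewrite invr_gt0.
have M0 : 0 < M by rewrite /M; have := cabs_ge0 q'; lra.
have GM w : cabs w = M -> G w = w.
  move=> wM; apply: GN => -[w0 nw]; apply: nw; apply: subset_closure; apply: dO.
  rewrite sub0r cabsN cabsV wM invf_plt ?posrE //.
  by rewrite /M; have := cabs_ge0 q'; lra.
pose S := [set z : R[i] | cabs z = 1].
have MS z : S z -> cabs (M%:C * z) = M.
  by move=> z1; rewrite cabsM z1 mulr1 cabs_real gtr0_norm.
have csM (z : R[i]) (s : R) : {for (z, s), continuous (fun p : R[i] * R => (M *
  p.2)%:C * p.1)}.
  apply: ccontM; last exact: cvg_fst.
  apply: (@comp_snd R[i] R R[i] (fun s => (M * s)%:C) z s).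
  apply: (@continuous_comp _ _ _ (fun s => M * s)); last exact: realC_continuous.
  by apply: rcontM; [exact: rcont_cst|move=> A].
(* The circle of radius [M] is shrunk under [G], which misses [q']; then [q'] is moved to 0. As [G]
   is the identity on that circle, the two quotients telescope to [M * z / (G 0 - q')]. *)
have [|k1 k1P] := @sqrt_homotopy R R[i] (fun z s => G ((M * s)%:C * z) - q') S.
  move=> z s z1 s01; split; first by rewrite subr_eq0 Gq.
  apply: ccontB; last exact: ccont_cst.
  exact: (@continuous_comp _ _ _ (fun p : R[i] * R => (M * p.2)%:C * p.1) G (z,
    s) (csM z s) (cG _)).
have [|k2 k2P] := @sqrt_homotopy R R[i] (fun z s => M%:C * z - (1 - s)%:C * q') S.
  move=> z s z1 /andP[s0 s1]; split.
    rewrite subr_eq0; apply/eqP => /(congr1 (@cabs R)).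
    rewrite MS // cabsM cabs_real ger0_norm ?subr_ge0 // => E.
    have : (1 - s) * cabs q' <= cabs q' by apply: ler_piMl; [exact: cabs_ge0|lra].
    by rewrite -E /M; lra.
  apply: ccontB.
    by apply: ccontM; [exact: ccont_cst|exact: cvg_fst].
  apply: ccontM; last exact: ccont_cst.
  apply: (@comp_snd R[i] R R[i] (fun s => (1 - s)%:C) z s).
  apply: (@continuous_comp _ _ _ (fun s : R => 1 - s)); last exact: realC_continuous.
  by apply: rcontB; [exact: rcont_cst|move=> A].
apply: (@odd_no_sqrt R (fun z => M%:C * z) (fun z => sqrtc (G 0 - q') * (k1 z *
  k2 z))) => z z1.
have [c1 e1] := k1P z z1; have [c2 e2] := k2P z z1; split.
- exact: (ccontM (@ccont_cst _ _ z _) (ccontM c1 c2)).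
- rewrite !exprMn sqr_sqrtc e1 e2 mulr1 mulr0 subrr subr0 rmorph0 rmorph1 !mul0r
  mul1r subr0.
  have m1 : G 0 - q' != 0 by rewrite subr_eq0 Gq.
  have m2 : M%:C * z - q' != 0 by rewrite subr_eq0 -(GM (M%:C * z)) ?MS // Gq.
  by rewrite (GM (M%:C * z) (MS z z1)) mulrA [X in X * _]mulrC (divfK m1) mulrC divfK.
- by rewrite -cabs_gt0 MS.
- by rewrite mulrN.
Qed.

(** * Trajectories of the Loewner equation *)

Lemma is_derive_Re_Im (R : realType) (w : R -> R[i]) (t : R) (l : R[i]) :
  0 < t -> has_time_derivative w t l ->
  is_derive t 1 (fun s => complex.Re (w s)) (complex.Re l) /\
  is_derive t 1 (fun s => complex.Im (w s)) (complex.Im l).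
Proof.
move=> t0 wl.
have wl' : (w s - w t) / (s - t)%:C @[s --> t^'] --> l.
  move=> A /wl; rewrite /nbhs /= /within /= => nA.
  have P : \forall s \near t^', 0 <= s.
    apply: (@nbhs_dnbhs _ t); apply: (@filterS _ (nbhs t) _ _ _ _ (lt_nbhsr t0)).
    by move=> s /ltW.
  by apply: (@filterS2 _ (t^') _ _ _ _ _ nA P) => s; exact.
have D (p : R[i] -> R) : (forall z a, p (z * a%:C) = p z * a) ->
    (forall z v, p (z - v) = p z - p v) -> continuous p ->
    is_derive t 1 (fun s => p (w s)) (p l).
  move=> pZ pB cp; apply/is_derive1_caratheodory.
  exists (fun s => if s == t then p l else (p (w s) - p (w t)) / (s - t)); split.
  - by move=> s; case: eqVneq => [->|st]; rewrite ?subrr ?mulr0 // divfK // subr_eq0.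
  - apply/continuous_withinNx; rewrite eqxx.
    have H : p ((w s - w t) / (s - t)%:C) @[s --> t^'] --> p l.
      exact: (@cvg_comp _ _ _ _ p _ _ _ wl' (cp l)).
    apply: cvg_trans H; apply: near_eq_cvg.
    have := @nbhs_dnbhs_neq _ t; apply: (@filterS _ (t^')) => s /= st.
    by rewrite (negbTE st) -fmorphV pZ pB.
  - by rewrite eqxx.
split; apply: D.
- by case=> x y a /=; rewrite mulr0 subr0.
- by move=> z v; rewrite raddfB.
- exact: Re_continuous.
- by case=> x y a /=; rewrite mulr0 add0r.
- by move=> z v; rewrite raddfB.
- exact: Im_continuous.
Qed.

Section Loewner_trajectory.
Context (R : realType) (w lam : R -> R[i]) (s T : R).
Hypothesis s0 : 0 < s.
Hypothesis sT : s < T.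
Hypothesis w1 : forall t, s <= t <= T -> cabs (w t) < 1.
Hypothesis lam1 : forall t, cabs (lam t) = 1.
Let vel t := - w t * ((lam t + w t) / (lam t - w t)).
Hypothesis ode : forall t, s <= t <= T -> has_time_derivative w t (vel t).

Let lw t : s <= t <= T -> lam t - w t != 0.
Proof.
move=> st; rewrite subr_eq0; apply/eqP => E; have := w1 st.
by rewrite -E lam1 ltxx.
Qed.

Let dw t : s <= t <= T ->
  is_derive t 1 (fun s => complex.Re (w s)) (complex.Re (vel t)) /\
  is_derive t 1 (fun s => complex.Im (w s)) (complex.Im (vel t)).
Proof.
move=> /[dup] st /andP[st1 st2]; apply: is_derive_Re_Im; last exact: ode.
exact: lt_le_trans st1.
Qed.

Let cw t : s <= t <= T -> {for t, continuous w}.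
Proof.
move=> /dw[[dR _] [dI _]].
have -> : w = fun t => complex.Re (w t) +i* complex.Im (w t).
  by apply/funext => x; case: (w x).
by apply: continuous_Complex; apply: differentiable_continuous;
  exact/derivable1_diffP.
Qed.

Let vel_le t d : s <= t <= T -> 0 < d -> d <= cabs (lam t - w t) -> cabs (vel t)
  <= 2 / d.
Proof.
move=> st d0 dl; rewrite /vel !cabsM cabsN cabsV mulrA.
have l0 : 0 < cabs (lam t - w t) by rewrite cabs_gt0 lw.
apply: ler_pM => //; [by rewrite mulr_ge0 ?cabs_ge0|by rewrite invr_ge0 cabs_ge0| |].
  have := cabsD (lam t) (w t); rewrite lam1; have := w1 st; have := cabs_ge0 (w t).
  have := cabs_ge0 (lam t + w t); nra.
by rewrite lef_pV2 ?posrE.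
Qed.

(** The constant is twice that of [vel_le], because the mean value theorem is applied to the real
    and imaginary parts separately. *)
Let lipschitz (a b d : R) : s <= a -> a < b -> b <= T -> 0 < d ->
  (forall t, a < t < b -> d <= cabs (lam t - w t)) ->
  cabs (w b - w a) <= 4 / d * (b - a).
Proof.
move=> sa ab bT d0 H.
have st t : a <= t <= b -> s <= t <= T by lra.
have D (p : R[i] -> R) : (forall z, `|p z| <= cabs z) -> continuous p ->
    (forall z v, p (z - v) = p z - p v) ->
    (forall t, s <= t <= T -> is_derive t 1 (fun s => p (w s)) (p (vel t))) ->
    `|p (w b - w a)| <= 2 / d * (b - a).
  move=> pc cp pB dp; rewrite pB.
  have [|c|c] := @MVT R (fun s => p (w s)) (fun t => p (vel t)) a b ab.
  - by move=> x; rewrite in_itv /= => xab; apply: dp; lra.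
  - apply: continuous_within => x; rewrite /= in_itv /= => /st /cw cx.
    exact: (@continuous_comp _ _ _ w p x cx (cp _)).
  - rewrite in_itv /= => cab ->; rewrite normrM (gtr0_norm (_ : 0 < b - a))
    ?subr_gt0 //.
    rewrite ler_pM2r ?subr_gt0 //; apply: le_trans (pc _) _.
    by apply: vel_le => //; [lra|exact: H].
apply: le_trans (cabs_le _) _.
have := D _ (@Re_le_cabs R) (@Re_continuous R) (fun z v => raddfB (@complex.Re R)
  z v) (fun t tt => (dw tt).1).
have := D _ (@Im_le_cabs R) (@Im_continuous R) (fun z v => raddfB (@complex.Im R)
  z v) (fun t tt => (dw tt).2).
have -> : 4 / d * (b - a) = 2 / d * (b - a) + 2 / d * (b - a) by field;
  rewrite gt_eqF.
lra.
Qed.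

(** If the trajectory came within [3 / 8 * e] of [c], let [m] be the last such time. After [m] it is
    at least [e / 4] away from the driving point, so it moves by at most [16 * (T - m) / e], hence
    by at most [e / 16]; but it must cover at least [e / 8] by time [T]. *)
Let stays_away (c : R[i]) (e : R) : 0 < e -> (T - s) * 256 <= e ^+ 2 ->
  (forall t, s <= t <= T -> cabs (lam t - c) <= e / 8) ->
  e / 2 <= cabs (w T - c) ->
  forall t, s <= t <= T -> e / 4 <= cabs (lam t - w t).
Proof.
move=> e0 Ts lc wT.
suff far t : s <= t <= T -> 3 / 8 * e < cabs (w t - c).
  move=> t st; have := far t st; have := lc t st.
  by have := cabs_tri (w t) (lam t) c; rewrite (cabsC (w t) (lam t)); lra.
move=> st; rewrite ltNge; apply/negP => tA.
pose A := [set t | s <= t <= T /\ cabs (w t - c) <= 3 / 8 * e].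
have cc t' : s <= t' <= T -> {for t', continuous (fun t => cabs (w t - c))}.
  by move=> st'; apply: cont_cabs; apply: ccontB; [exact: cw|exact: ccont_cst].
have clA : closed A.
  rewrite -openC openE => t' nA; have [st'|st'] := boolP (s <= t' <= T).
    have lt' : 3 / 8 * e < cabs (w t' - c) by rewrite ltNge; apply/negP => ?;
      exact: nA.
    have N : \forall x \near t', 3 / 8 * e < cabs (w x - c).
      exact: (cvgr_gt _ (cc t' st') _ lt').
    apply: (@filterS _ (nbhs t') _ _ _ _ N) => x /= xe [_].
    by rewrite leNgt xe.
  move: st'; rewrite negb_and -!ltNge => /orP[ts|Tt].
    apply: (@filterS _ (nbhs t') _ _ _ _ (lt_nbhsl ts)) => x /= xs [/andP[sx _] _].
    by move: sx; rewrite leNgt xs.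
  apply: (@filterS _ (nbhs t') _ _ _ _ (lt_nbhsr Tt)) => x /= xs [/andP[_ sx] _].
  by move: sx; rewrite leNgt xs.
have cA : compact A.
  apply: (subclosed_compact clA (@segment_compact R s T)) => x [sx _].
  by rewrite /= in_itv.
have [||m /set_mem[sm mA] mmax] := @compact_EVT_max R R id A _ cA.
- by exists t.
- by apply: continuous_subspaceT => x.
have mT : m < T.
  rewrite lt_neqAle; apply/andP; split; last by lra.
  by apply/eqP => mT; move: mA; rewrite mT; lra.
have := @lipschitz m T (e / 4) _ mT (lexx T) _ _.
have -> : 4 / (e / 4) * (T - m) = 16 * (T - m) / e by field; rewrite gt_eqF.
move=> L.
have : cabs (w T - w m) <= 16 * (T - m) / e.
  apply: L; [lra|lra|] => x xm.
  have xfar : 3 / 8 * e < cabs (w x - c).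
    rewrite ltNge; apply/negP => xA.
    have sx : s <= x <= T by lra.
    have xA' : x \in A by rewrite inE.
    by have := mmax x xA'; lra.
  have sx : s <= x <= T by lra.
  have := lc x sx; have := cabs_tri (w x) (lam x) c;
    rewrite (cabsC (w x) (lam x)); lra.
rewrite ler_pdivlMr // => LL.
have L2 : e / 8 <= cabs (w T - w m) by have := cabs_tri (w T) (w m) c; lra.
nra.
Qed.

(* While the trajectory stays away from the driving point, 1 - |w|^2 grows at most
   exponentially. *)
Lemma Loewner_trajectory_bound (c : R[i]) (e : R) : 0 < e -> (T - s) * 256 <= e
  ^+ 2 ->
  (forall t, s <= t <= T -> cabs (lam t - c) <= e / 8) ->
  e / 2 <= cabs (w T - c) ->
  1 - cabs (w T) ^+ 2 <= (1 - cabs (w s) ^+ 2) * expR (32 / e ^+ 2 * (T - s)).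
Proof.
move=> e0 Ts lc wT; have away := stays_away e0 Ts lc wT.
(* By [stays_away] the squared distance to the driving point is at least [e ^+ 2 / 16], which bounds
   the growth rate [2 * |w|^2 / |lam - w|^2] of [1 - |w|^2]. *)
pose C := 32 / e ^+ 2.
pose x t := complex.Re (w t); pose y t := complex.Im (w t).
pose m t := 1 - (x t ^+ 2 + y t ^+ 2).
have mE t : m t = 1 - cabs (w t) ^+ 2 by rewrite cabs_sqr.
pose dm t := - (2 * (x t * complex.Re (vel t) + y t * complex.Im (vel t))).
have dmP t : s <= t <= T -> is_derive t 1 m (dm t).
  move=> /dw[dx dy].
  have -> : m = (fun=> 1) - (x ^+ 2 + y ^+ 2) by apply/funext => t'.
  have -> : dm t = 0 - ((2%:R * x t ^+ 1) *: complex.Re (vel t) + (2%:R * y t ^+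
    1) *: complex.Im (vel t)).
    by rewrite /dm /GRing.scale /= !expr1; ring.
  exact: (is_deriveB (is_derive_cst _ _ _) (is_deriveD (is_deriveX 2 dx)
    (is_deriveX 2 dy))).
have m_gt0 t : s <= t <= T -> 0 < m t.
  by move=> /w1 wt; rewrite mE subr_gt0 expr_lt1 // cabs_ge0.
have dm_le t : s <= t <= T -> dm t <= C * m t.
  move=> st; have l0 := lw st.
  pose D := cabs (lam t - w t) ^+ 2.
  have D0 : 0 < D by rewrite exprn_gt0 // cabs_gt0.
  (* The real part of [(lam + w) / (lam - w)] is [(1 - |w|^2) / |lam - w|^2]; the identity is
     checked in coordinates with the denominator cleared. *)
  have DE : dm t * D = 2 * cabs (w t) ^+ 2 * m t.
    have E : vel t * (lam t - w t) = - w t * (lam t + w t) by rewrite /vel mulrA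
      divfK.
    have lE : cabs (lam t) ^+ 2 = 1 by rewrite lam1 expr1n.
    move: E lE; rewrite /dm /D mE !cabs_sqr /x /y.
    case: (lam t) => a b; case: (w t) => p q; case: (vel t) => f g.
    rewrite !mulcE /= => -[E1 E2] ab.
    have F : f * ((a - p) ^+ 2 + (b - q) ^+ 2) =
      (a - p) * (f * (a - p) - g * (b - q)) + (b - q) * (f * (b - q) + g * (a -
        p)) by ring.
    have G : g * ((a - p) ^+ 2 + (b - q) ^+ 2) =
      (a - p) * (f * (b - q) + g * (a - p)) - (b - q) * (f * (a - p) - g * (b -
        q)) by ring.
    rewrite E1 E2 in F G.
    set S := (a - p) ^+ 2 + (b - q) ^+ 2 in F G *.
    have -> : - (2 * (p * f + q * g)) * S = - 2 * (p * (f * S) + q * (g * S)) by ring.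
    rewrite F G -[X in _ = _ * (X - _)]ab; ring.
  have dmE : dm t = 2 * cabs (w t) ^+ 2 * m t / D by rewrite -DE mulfK // gt_eqF.
  have W1 : cabs (w t) ^+ 2 <= 1 by rewrite expr_le1 // ?cabs_ge0 // ltW // w1.
  have DL : e ^+ 2 / 16 <= D.
    have := away t st; have := cabs_ge0 (lam t - w t); rewrite /D; nra.
  rewrite dmE ler_pdivrMr //.
  have M := m_gt0 t st.
  have e2 : 0 < e ^+ 2 by rewrite exprn_gt0.
  have CD : 2 <= C * D.
    by rewrite /C mulrAC ler_pdivlMr //; lra.
  by rewrite [leRHS]mulrAC ler_pM2r //; nra.
(* Gronwall by an integrating factor: [N] has nonpositive derivative. *)
pose N t := m t * expR (- C * t).
have dN t : s <= t <= T -> is_derive t 1 N ((dm t - C * m t) * expR (- C * t)).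
  move=> st; have dmt := dmP t st.
  have dE : is_derive t 1 (fun t => expR (- C * t)) (- C * expR (- C * t)).
    have dl : is_derive t 1 (fun t => - C * t) (- C).
      have := @is_deriveZ _ _ _ id (- C) t 1 1 (is_derive_id _ _).
      by rewrite /GRing.scale /= mulr1.
    have := @is_derive1_comp _ expR (fun t => - C * t) t _ _ (is_derive_expR _) dl.
    by rewrite mulrC.
  have -> : (dm t - C * m t) * expR (- C * t) =
     m t *: (- C * expR (- C * t)) + expR (- C * t) *: dm t.
    by rewrite /GRing.scale /=; ring.
  exact: is_deriveM.
have [||z] := @MVT R N (fun t => (dm t - C * m t) * expR (- C * t)) s T sT.
- by move=> z; rewrite in_itv /= => zz; apply: dN; lra.
- apply: continuous_within => z; rewrite /= in_itv /= => /dN[dz _].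
  by apply: differentiable_continuous; exact/derivable1_diffP.
rewrite in_itv /= => zz NE.
have zz' : s <= z <= T by lra.
have N0 : N T - N s <= 0.
  rewrite NE; apply: mulr_le0_ge0; last by lra.
  apply: mulr_le0_ge0; first by rewrite subr_le0 dm_le.
  exact: expR_ge0.
rewrite -!mE -/C.
have -> : expR (C * (T - s)) = expR (- C * s) * expR (C * T).
  by rewrite -expRD; congr expR; ring.
rewrite mulrA -/(N s).
have -> : m T = N T * expR (C * T).
  by rewrite /N -mulrA -expRD mulNr addNr expR0 mulr1.
by rewrite ler_pM2r ?expR_gt0 // -subr_le0.
Qed.
End Loewner_trajectory.

(** * The inverted curve *)

Lemma within_continuous_at (T U : topologicalType) (A : set T) (g : T -> U) (x : T) :
  {within A, continuous g} -> nbhs x A -> {for x, continuous g}.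
Proof.
move=> /subspace_continuousP H nA B nB.
have W : within A (nbhs x) (g @^-1` B) := H x (nbhs_singleton nA) B nB.
by apply: (@filterS2 _ (nbhs x) _ _ _ _ _ nA W) => y Ay /(_ Ay).
Qed.

Lemma sphere_cvg_point (R : realType) (T : Type) (F : set_system T) (FF : Filter F)
    (g : T -> R[i]) (p : R[i]) :
  to_sphere (g t) @[t --> F] --> to_sphere p -> g @ F --> p.
Proof.
move=> gp A nA.
have := gp _ (@one_point_compactification_some_nbhs R[i] p A nA).
by apply: (@filterS _ F) => t [a Aa [E]]; rewrite /= -E.
Qed.

Lemma sphere_cvg_oo (R : realType) (T : Type) (F : set_system T) (FF : Filter F)
    (g : T -> R[i]) (M : R) :
  to_sphere (g t) @[t --> F] --> sphere_oo R -> \forall t \near F, M < cabs (g t).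
Proof.
move=> gp.
have : nbhs (sphere_oo R) ((Some @` (~` [set z : R[i] |
  cabs (z - 0) <= M])) `|` [set None]).
  exists [set z : R[i] | cabs (z - 0) <= M] => //; split.
    exact: compact_cabs_le.
  exact: closed_cabs_le.
move=> /gp; apply: (@filterS _ F) => t /= [[z /= zM []] <-|//].
by rewrite ltNge; apply/negP; rewrite -[z]subr0.
Qed.

Lemma closure_to_sphere (R : realType) (A : set R[i]) (z : R[i]) :
  closure (@to_sphere R @` A) (to_sphere z) <-> closure A z.
Proof.
split=> H B nB.
  have [_ [[a Aa <-] [b Bb [ba]]]] := H _ (@one_point_compactification_some_nbhs
    R[i] z B nB).
  by exists a; split=> //; rewrite -ba.
have [a [Aa Ba]] := H ((@to_sphere R) @^-1` B) nB.
by exists (to_sphere a); split=> //; exists a.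
Qed.

Lemma boundary_to_sphere (R : realType) (A : set R[i]) (z : R[i]) :
  open A -> boundary (@to_sphere R @` A) (to_sphere z) <-> closure A z /\ ~ A z.
Proof.
move=> oA; rewrite /boundary /setD /= closure_to_sphere.
suff -> : (@to_sphere R @` A)° (to_sphere z) <-> A z by [].
split=> [H|Az].
  have [a Aa []] : (@to_sphere R @` A) (to_sphere z) by exact: (@nbhs_singleton
    (sphere R) _ _ H).
  by move=> <-.
apply: (@one_point_compactification_some_nbhs _ z).
exact: open_nbhs_nbhs.
Qed.

Section inverted_curve.
Context (R : realType) (Gamma : R -> R[i]) (l : R[i]).
Hypothesis cGamma : open_curve Gamma.
Hypothesis Gamma_neq0 : forall t, 0 < t -> Gamma t != 0.
Hypothesis Gamma_oo : curve_to_sphere Gamma t @[t --> +oo] --> sphere_oo R.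
Hypothesis Gamma_l : (Gamma t)^-1 @[t --> 0^'+] --> l.

(* The curve [1 / Gamma] reparametrized by ]0, 1[ and extended to R by its
   limits. *)
Definition inverted_curve (s : R) : R[i] :=
  if s <= 0 then l else if s < 1 then (Gamma (s / (1 - s)))^-1 else 0.
Local Notation eta := inverted_curve.

Lemma inverted_curve0 : eta 0 = l.
Proof. by rewrite /eta lexx. Qed.

Lemma inverted_curve1 : eta 1 = 0.
Proof. by rewrite /eta ltxx leNgt ltr01. Qed.

Lemma inverted_curveE s : 0 < s < 1 -> eta s = (Gamma (s / (1 - s)))^-1.
Proof. by case/andP => s0 s1; rewrite /eta leNgt s0 s1. Qed.

Lemma time_gt0 (s : R) : 0 < s < 1 -> 0 < s / (1 - s).
Proof. by case/andP => s0 s1; rewrite divr_gt0 // subr_gt0. Qed.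

Lemma inverted_curve_time t : 0 < t -> 0 < t / (1 + t) < 1 /\ eta (t / (1 + t)) =
  (Gamma t)^-1.
Proof.
move=> t0; have t1 : 0 < 1 + t by lra.
have t01 : 0 < t / (1 + t) < 1.
  by rewrite divr_gt0 //= ltr_pdivrMr // mul1r; lra.
split=> //; rewrite inverted_curveE //; congr (Gamma _)^-1.
by field; rewrite gt_eqF //= -addrA subrr addr0 oner_eq0.
Qed.

Lemma curve_continuous t : 0 < t -> {for t, continuous Gamma}.
Proof.
move=> t0; case: cGamma => cG _; apply: (within_continuous_at cG).
apply: (@filterS _ (nbhs t) _ _ _ _ (lt_nbhsr t0)) => x /= x0.
by rewrite in_itv /= x0.
Qed.

Lemma inverted_curve_continuous : continuous eta.
Proof.
move=> s; have [s0|s0|->] := ltgtP s 0.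
- apply: (continuous_eq_near _ (@ccont_cst _ _ s l)).
  apply: (@filterS _ (nbhs s) _ _ _ _ (lt_nbhsl s0)) => x /= x0.
  by rewrite /eta ltW.
- have [s1|s1|->] := ltgtP s 1.
  + have c : {for s, continuous (fun s : R => (Gamma (s / (1 - s)))^-1 : R[i])}.
      apply: ccontV; last by rewrite Gamma_neq0 // time_gt0 // s0.
      apply: (@continuous_comp _ _ _ (fun s : R => s / (1 - s))); last first.
        by apply: curve_continuous; rewrite time_gt0 // s0.
      apply: rcontM; first by move=> A.
      apply: rcontV; last by rewrite subr_eq0 gt_eqF.
      by apply: rcontB; [exact: rcont_cst|move=> A].
    apply: (continuous_eq_near _ c).
    apply: (@filterS2 _ (nbhs s) _ _ _ _ _ (lt_nbhsr s0) (lt_nbhsl s1)) => x /= x0 x1.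
    by rewrite inverted_curveE // x0.
  + apply: (continuous_eq_near _ (@ccont_cst _ _ s 0)).
    apply: (@filterS _ (nbhs s) _ _ _ _ (lt_nbhsr s1)) => x /= x1.
    by rewrite /eta leNgt (lt_trans ltr01 x1) /= ltNge (ltW x1).
  + apply/(@cvg_cabsP R _ (nbhs (1 : R)) (nbhs_filter _) eta (eta 1)) => e e0.
    rewrite inverted_curve1.
    have [N [_ NG]] := sphere_cvg_oo _ e^-1 Gamma_oo.
    (* This [d] forces [x > 1 / 2] and [N * (1 - x) < 1 / 2], hence [N < x / (1 - x)]; the absolute
       value covers a negative [N]. *)
    pose d := (2 * (`|N| + 1))^-1.
    have N0 := normr_ge0 N.
    have d0 : 0 < d by rewrite invr_gt0; lra.
    have d2 : d <= 1 / 2 by rewrite /d -[1 / 2]mulrC mulr1 lef_pV2 ?posrE; lra.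
    apply/nbhs_ballP; exists d => //= x; rewrite /ball /= => x1.
    rewrite sub0r cabsN; have [x1'|x1'] := ltP x 1; last first.
      by rewrite /eta leNgt (lt_le_trans ltr01 x1') /= (ltNge x 1) x1' /= cabs0.
    have x0 : 0 < x by move: x1; rewrite ltr_norml; lra.
    rewrite inverted_curveE ?x0 // cabsV invf_plt ?posrE ?cabs_gt0 ?Gamma_neq0
      ?time_gt0 ?x0 //.
    apply: NG; rewrite ltr_pdivlMr ?subr_gt0 //.
    have : N * (1 - x) <= `|N| * d.
      apply: le_trans (_ : `|N| * (1 - x) <= _);
        first by rewrite ler_wpM2r ?ler_norm //; lra.
      by rewrite ler_wpM2l //; move: x1; rewrite ltr_norml; lra.
    have : `|N| * d < 1 / 2.
      by rewrite /d invfM mulrCA -[1 / 2]mulr1 mul1r ltr_pM2l ?invr_gt0 //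
        ltr_pdivrMr ?mul1r; lra.
    move: x1; rewrite ltr_norml; lra.
- apply/(@cvg_cabsP R _ (nbhs (0 : R)) (nbhs_filter _) eta (eta 0)) => e e0.
  rewrite inverted_curve0.
  have N : \forall x \near 0^'+, cabs (l - (Gamma x)^-1) < e.
    exact: ((@cvg_cabsP R _ (0^'+) _ _ l).1 Gamma_l e e0).
  have /nbhs_ballP[d /= d0 dG] : \forall x \near (0 : R), 0 < x -> cabs (l -
    (Gamma x)^-1) < e by exact: N.
  (* For [0 < x < 1 / 2] the original time [x / (1 - x)] is below [2 * x], hence below [d]. *)
  pose d' := Num.min (d / 2) (1 / 2).
  have d'0 : 0 < d' by rewrite lt_min; lra.
  apply/nbhs_ballP; exists d' => //= x; rewrite /ball /= sub0r normrN lt_min =>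
    /andP[x1 x2].
  have [x0|x0] := leP x 0; first by rewrite /eta x0 subrr cabs0.
  rewrite gtr0_norm // in x1 x2.
  rewrite inverted_curveE; last by rewrite x0; lra.
  have t0 : 0 < x / (1 - x) by rewrite time_gt0 // x0; lra.
  apply: (dG (x / (1 - x))) => //=.
  rewrite /ball /= sub0r normrN gtr0_norm // ltr_pdivrMr; last by lra.
  nra.
Qed.

Lemma inverted_curve_inj s t : 0 < s <= 1 -> 0 < t <= 1 -> eta s = eta t -> s = t.
Proof.
have n0 x : 0 < x < 1 -> eta x != 0.
  by move=> x01; rewrite inverted_curveE // invr_eq0 Gamma_neq0 // time_gt0.
move=> /andP[s0 s1] /andP[t0 t1] E.
have [s1'|s1'] := ltP s 1; have [t1'|t1'] := ltP t 1; last by lra.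
- have s01 : 0 < s < 1 by rewrite s0.
  have t01 : 0 < t < 1 by rewrite t0.
  move: E; rewrite !inverted_curveE // => /invr_inj E.
  case: cGamma => _ iG.
  have : s / (1 - s) = t / (1 - t).
    by apply: iG => //; rewrite inE /= in_itv /= time_gt0.
  move/(congr1 (fun x => x / (1 + x))).
  have F (x : R) : x < 1 -> x / (1 - x) / (1 + x / (1 - x)) = x.
    by move=> x1; field; rewrite subr_eq0 gt_eqF //= addrNK oner_eq0.
  by rewrite !F.
- by exfalso; move/eqP: E; apply/negP; rewrite (_ : t = 1) ?inverted_curve1 ?n0
  ?s0 //; lra.
- by exfalso; move/esym/eqP: E; apply/negP; rewrite (_ : s = 1) ?inverted_curve1
  ?n0 ?t0 //; lra.
Qed.

(** The endpoint [s = 1] can be included since [eta 1 = 0], which no [z] turns into 1; this makes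
    the range of [s] compact. *)
Lemma curve_tail_inverted t z : 0 < t ->
  (~` curve_tail Gamma t) z <-> (forall s, t / (1 + t) <= s <= 1 -> z * eta s != 1).
Proof.
move=> t0; have [/andP[r0 r1] _] := inverted_curve_time t0; split=> H.
  move=> s /andP[ts s1]; apply/eqP => zs.
  have s0 : 0 < s by apply: lt_le_trans ts.
  have {}s1 : s < 1.
    rewrite lt_neqAle s1 andbT; apply/eqP => E.
    by move: zs; rewrite E inverted_curve1 mulr0 => /eqP; rewrite eq_sym oner_eq0.
  have s01 : 0 < s < 1 by rewrite s0.
  apply: H; exists (s / (1 - s)).
    rewrite /= in_itv /= andbT ler_pdivlMr ?subr_gt0 //.
    by move: ts; rewrite ler_pdivrMr; lra.
  have G0 : Gamma (s / (1 - s)) != 0 by rewrite Gamma_neq0 // time_gt0.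
  by apply: (mulIf (invr_neq0 G0)); rewrite divff // -inverted_curveE.
move=> [x tx xz]; have x0 : 0 < x by move: tx; rewrite /= in_itv /= andbT; lra.
have [/andP[x1 x2] E] := inverted_curve_time x0.
have /negP[] : z * eta (x / (1 + x)) != 1.
  apply: H; rewrite (ltW x2) andbT.
  rewrite ler_pdivrMr; last by lra.
  rewrite mulrAC ler_pdivlMr; last by lra.
  by move: tx; rewrite /= in_itv /= andbT; lra.
by rewrite E -xz divff // Gamma_neq0.
Qed.

(** Closing the curve in the plane adds only its limit at time 0, the parameter [s = 0]. If that
    limit is infinite, then [l = 0] and no [z] solves the equation there. *)
Lemma closure_curve (z : R[i]) : z != 0 ->
  closure (Gamma @` `]0, +oo[) z <-> exists2 s, 0 <= s <= 1 & z * eta s = 1.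
Proof.
move=> z0; split=> [H|[s /andP[s0 s1] zs]].
  apply: contrapT => nz.
  have N : forall s, 0 <= s <= 1 -> z * eta s != 1.
    by move=> s s01; apply/eqP => zs; apply: nz; exists s.
  have := @avoid_near R eta 0 1 z (fun s _ => @inverted_curve_continuous s) N.
  move=> /H[_ [[t t0 <-] tN]].
  have {}t0 : 0 < t by move: t0; rewrite /= in_itv /= andbT.
  have [/andP[r0 r1] E] := inverted_curve_time t0.
  have r01 : 0 <= t / (1 + t) <= 1 by rewrite (ltW r0) (ltW r1).
  by have := tN _ r01; rewrite E divff ?eqxx // Gamma_neq0.
have zE : z = (eta s)^-1.
  have es : eta s != 0 by apply/eqP => E; move: zs; rewrite E mulr0 => /eqP;
    rewrite eq_sym oner_eq0.
  by apply: (mulIf es); rewrite mulVf.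
have [s0'|s0'] := ltP 0 s.
  have s1' : s < 1.
    rewrite lt_neqAle s1 andbT; apply/eqP => E.
    by move: zs; rewrite E inverted_curve1 mulr0 => /eqP; rewrite eq_sym oner_eq0.
  apply: subset_closure; exists (s / (1 - s));
    last by rewrite zE inverted_curveE ?invrK // s0'.
  by rewrite /= in_itv /= andbT time_gt0 // s0'.
have sE : s = 0 by lra.
rewrite sE inverted_curve0 in zE zs.
have l0 : l != 0 by apply/eqP => E; move: zs; rewrite E mulr0 => /eqP;
  rewrite eq_sym oner_eq0.
move=> B nB; rewrite zE in nB.
have W := Gamma_l (near_invc l0 nB).
have P : \forall t \near 0^'+, (0 : R) < t by exact: nbhs_right_gt.
have [t [t0 Bt]] := @filter_ex _ (0^'+) _ _ (@filterI _ (0^'+) _ _ _ P W).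
exists (Gamma t); split; first by exists t => //; rewrite /= in_itv /= t0.
by move: Bt; rewrite /= invrK.
Qed.
End inverted_curve.

(** * The Loewner chain of a curve *)

Lemma disk_nbhs (R : realType) (z : R[i]) : disk z -> nbhs z (@disk R).
Proof.
rewrite diskE => z1; apply/nbhs_cabsP; exists (1 - cabs z); first by rewrite subr_gt0.
by move=> w zw; rewrite diskE; have := cabsD (w - z) z; rewrite subrK cabsC; lra.
Qed.

Lemma continuous_preimage_nbhs (T U : topologicalType) (g : T -> U) (x : T) (B :
  set U) :
  {for x, continuous g} -> nbhs (g x) B -> nbhs x (g @^-1` B).
Proof. by move=> cg nB; exact: (cg B nB). Qed.

Section Loewner_chain.
Context (R : realType) (F0 : R[i] -> R[i]) (Omega0 : set R[i]) (Gamma : R -> R[i]).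
Context (F : R[i] -> R -> R[i]) (u : R -> R) (f : R[i] -> R -> R[i]).
Hypothesis domain_Omega0 : is_domain Omega0.
Hypothesis conformal_F0 : conformal_map (@disk R) Omega0 F0.
Hypothesis F0_0 : F0 0 = 0.
Hypothesis curve_Gamma : open_curve Gamma.
Hypothesis boundary_Omega0 :
  curve_hat Gamma = boundary (@to_sphere R @` Omega0).
Hypothesis Gamma_oo : curve_to_sphere Gamma t @[t --> +oo] --> sphere_oo R.
Hypothesis conformal_F : forall t : R, 0 < t ->
  conformal_map (@disk R) (~` curve_tail Gamma t) (F^~ t).
Hypothesis f_def : forall (z : R[i]) (t : R), disk z -> 0 <= t ->
  f z t = 'pinv_(fun=> 0) (@disk R) (F^~ t) (F0 z).

Lemma closure_curve_domain z :
  closure (Gamma @` `]0, +oo[) z <-> closure Omega0 z /\ ~ Omega0 z.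
Proof.
have [_ oO _] := domain_Omega0.
rewrite -boundary_to_sphere // -boundary_Omega0 -closure_to_sphere /curve_hat.
by rewrite image_comp.
Qed.

Lemma Omega0_0 : Omega0 0.
Proof.
by rewrite -F0_0; case: conformal_F0 => _ [fF _ _]; apply: fF;
  rewrite /disk /= normr0.
Qed.

Lemma curve_neq0 t : 0 < t -> Gamma t != 0.
Proof.
move=> t0; apply/eqP => Gt.
have /closure_curve_domain[_] : closure (Gamma @` `]0, +oo[) 0.
  by apply: subset_closure; exists t => //; rewrite /= in_itv /= t0.
by apply; exact: Omega0_0.
Qed.

Lemma curve_limit_neq0 (p : R[i]) : Gamma t @[t --> 0^'+] --> p -> p != 0.
Proof.
move=> Gp; apply/eqP => p0.
have /closure_curve_domain[_] : closure (Gamma @` `]0, +oo[) p.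
  move=> B nB; have P : \forall t \near 0^'+, (0 : R) < t by exact: nbhs_right_gt.
  have [t [t0 Bt]] := @filter_ex _ (0^'+) _ _ (@filterI _ (0^'+) _ _ _ P (Gp B nB)).
  by exists (Gamma t); split=> //; exists t => //; rewrite /= in_itv /= t0.
by rewrite p0; apply; exact: Omega0_0.
Qed.

(** * The chain seen through the inverted curve *)

Section limit.
Variable l : R[i].
Hypothesis Gamma_l : (Gamma t)^-1 @[t --> 0^'+] --> l.
Local Notation eta := (inverted_curve Gamma l).
Local Notation finv t := ('pinv_(fun=> 0) (@disk R) (F^~ t)).

Let ceta : continuous eta.
Proof. exact: inverted_curve_continuous curve_Gamma curve_neq0 Gamma_oo Gamma_l. Qed.

Lemma boundary_inverted (z : R[i]) :
  closure Omega0 z /\ ~ Omega0 z <-> exists2 s, 0 <= s <= 1 & z * eta s = 1.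
Proof.
have [->|z0] := eqVneq z 0.
  split=> [[_ H]|[s _ zs]]; first by case: (H Omega0_0).
  by exfalso; move: zs; rewrite mul0r => /eqP; rewrite eq_sym oner_eq0.
rewrite -closure_curve_domain.
exact: (closure_curve curve_Gamma curve_neq0 Gamma_oo Gamma_l z0).
Qed.

Lemma domain_avoids z s : Omega0 z -> 0 <= s <= 1 -> z * eta s != 1.
Proof.
move=> Oz s01; apply/eqP => zs.
by have [_] := (boundary_inverted z).2 (ex_intro2 _ _ s s01 zs).
Qed.

Lemma tail_complement (t : R) (z : R[i]) : 0 < t ->
  (~` curve_tail Gamma t) z <-> (forall s, t / (1 + t) <= s <= 1 -> z * eta s != 1).
Proof. exact: (curve_tail_inverted l curve_neq0). Qed.

Let rho_gt0 (t : R) : 0 < t -> 0 < t / (1 + t).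
Proof. by move=> t0; rewrite divr_gt0 //; lra. Qed.

Lemma domain_sub_tail t : 0 < t -> Omega0 `<=` ~` curve_tail Gamma t.
Proof.
move=> t0 z Oz; apply/(tail_complement _ t0) => s ts; apply: (domain_avoids Oz).
by have := rho_gt0 t0; lra.
Qed.

Lemma F_continuous t z : 0 < t -> disk z -> {for z, continuous (F^~ t)}.
Proof.
by move=> t0 dz; apply: derivable_complex_continuous;
  case: (conformal_F t0) => H _; exact: H.
Qed.

Lemma F_bij t : 0 < t -> set_bij (@disk R) (~` curve_tail Gamma t) (F^~ t).
Proof. by move=> /conformal_F[]. Qed.

Lemma finv_continuous (t : R) (y : R[i]) : 0 < t ->
  (~` curve_tail Gamma t) y -> {for y, continuous (finv t : R[i] -> R[i])}.
Proof.
move=> t0 Uy.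
have cF z : disk z -> {for z, continuous (F^~ t)} by exact: F_continuous.
have := @disk_pinv_continuous R (F^~ t) _ cF (F_bij t0) y Uy.
exact.
Qed.

(** Questions about the image of [f] become questions about [Omega0], since [F(., t)] covers all of
    [Omega0]. *)
Lemma f_image t : 0 < t ->
  (f^~ t) @` (@disk R) = [set w | disk w /\ Omega0 (F w t)].
Proof.
move=> t0; have [_ [fF0 _ sF0]] := conformal_F0.
apply/seteqP; split=> [_ [z dz <-]|w [dw /sF0[z dz zw]]].
  rewrite /= f_def ?ltW //; have Oz := fF0 _ dz.
  have Uz := domain_sub_tail t0 Oz; split; first exact: (disk_pinv (F_bij t0)).
  by rewrite (disk_pinvK (F_bij t0) Uz).
exists z => //; rewrite f_def ?ltW // zw.
exact: (disk_pinvKV (F_bij t0) dw).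
Qed.

(** A point off the curve and outside [Omega0] is outside the closure of [Omega0], whose boundary is
    on the curve. The preimage under [F(., t)] of the exterior of [Omega0] is then a nonempty open
    set omitted by [f]. *)
Lemma domain_complement (t : R) : 0 < t ->
  ~ (exists (c : R[i]) (U : set R[i]), nbhs c U /\ U `<=` @disk R `\` (f^~ t) @`
    (@disk R)) ->
  Omega0 = [set z | forall s, 0 <= s <= 1 -> z * eta s != 1].
Proof.
move=> t0 none; have [_ oO cO] := domain_Omega0.
apply/seteqP; split=> [z Oz s ss|z Xz]; first exact: domain_avoids.
apply: contrapT => nOz.
have ncl : ~ closure Omega0 z.
  move=> clz; have [s ss zs] := (boundary_inverted z).1 (conj clz nOz).
  by have := Xz s ss; rewrite zs eqxx.
have Uz : (~` curve_tail Gamma t) z.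
  by apply/(tail_complement _ t0) => s ss; apply: Xz; have := rho_gt0 t0; lra.
have [_ _ sF] := F_bij t0; have [c dc cE] := sF _ Uz.
have N : nbhs (F c t) (~` closure Omega0).
  apply: open_nbhs_nbhs; split; first exact/closed_openC/closed_closure.
  by rewrite cE.
have N' := continuous_preimage_nbhs (F_continuous t0 dc) N.
apply: none; exists c, (@disk R `&` (F^~ t) @^-1` (~` closure Omega0)); split.
  exact: (@filterI _ (nbhs c) _ _ _ (disk_nbhs dc) N').
move=> w [dw nw]; split; first exact: dw.
by rewrite (f_image t0) => -[_ Ow]; apply: nw; exact: subset_closure.
Qed.

(** [1 - z * eta s] is the constant [- eta s] times [z - Gamma t] with [t = s / (1 - s)], and
    [Gamma t] is omitted by [F(., t)]. *)
Lemma sqrt_inverted (s : R) : 0 < s < 1 -> exists h : R[i] -> R[i], forall z,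
  (forall t, s <= t <= 1 -> z * eta t != 1) ->
  {for z, continuous h} /\ h z ^+ 2 = 1 - z * eta s.
Proof.
move=> s1; have t1 := time_gt0 s1.
have nU : ~ (~` curve_tail Gamma (s / (1 - s))) (Gamma (s / (1 - s))).
  by apply; exists (s / (1 - s)) => //; rewrite /= in_itv /= lexx.
have cF z : disk z -> {for z, continuous (F^~ (s / (1 - s)))} by exact: F_continuous.
have [h hP] := sqrt_on_disk_image cF (F_bij t1) nU.
exists (fun z => sqrtc (- eta s) * h z) => z zs.
have [|c e] := hP z.
  apply/(tail_complement _ t1) => x xs; apply: zs.
  suff -> : s = s / (1 - s) / (1 + s / (1 - s)) by [].
  case/andP: s1 => s1 s2; field.
  by rewrite subr_eq0 gt_eqF //= addrNK oner_eq0.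
split; first exact: (ccontM (@ccont_cst _ _ z _) c).
rewrite exprMn sqr_sqrtc e inverted_curveE // mulrBr !mulNr mulVf ?curve_neq0 //.
by rewrite opprK addrC mulrC.
Qed.

(** The value [s0 = 1] stands for a curve that closes up at infinity, so both ways of meeting itself
    are covered. *)
Lemma open_omitted (s0 t : R) : 0 < s0 <= 1 -> l = eta s0 -> 0 < t ->
  exists (c : R[i]) (U : set R[i]), nbhs c U /\ U `<=` @disk R `\` (f^~ t) @`
    (@disk R).
Proof.
move=> s01 ls t0; apply: contrapT => none.
have [_ _ cO] := domain_Omega0.
have OX := domain_complement t0 none.
have e0 : eta 0 = eta s0 by rewrite inverted_curve0.
have ieta : forall s t, 0 < s <= 1 -> 0 < t <= 1 -> eta s = eta t -> s = t.
  exact: (inverted_curve_inj curve_Gamma curve_neq0).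
have := @closed_curve_separates R eta s0 s01 ceta ieta e0 (inverted_curve1 _ _)
  sqrt_inverted.
by rewrite -OX.
Qed.

(** * The landing of the slit on the unit circle *)

Hypothesis continuous_u : {within `[0, +oo[, continuous u}.
Hypothesis Loewner_ODE : forall (z : R[i]) (t : R), disk z -> 0 <= t ->
  has_time_derivative (f z) t
    (- f z t * ((expi (u t) + f z t) / (expi (u t) - f z t))).

Lemma f_disk (z : R[i]) (t : R) : disk z -> 0 < t -> disk (f z t).
Proof.
move=> dz t0; have [_ [fF0 _ _]] := conformal_F0; rewrite (f_def dz (ltW t0)).
exact: (disk_pinv (F_bij t0) (domain_sub_tail t0 (fF0 _ dz))).
Qed.

Lemma F_f (z : R[i]) (t : R) : disk z -> 0 < t -> F (f z t) t = F0 z.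
Proof.
move=> dz t0; have [_ [fF0 _ _]] := conformal_F0; rewrite (f_def dz (ltW t0)).
exact: (disk_pinvK (F_bij t0) (domain_sub_tail t0 (fF0 _ dz))).
Qed.

(** The image under [F(., s)] of a smaller closed disk is compact and misses [y], hence misses a
    neighbourhood of [y]. Preimages of points tending to an omitted point therefore tend to the unit
    circle. *)
Lemma near_tip_norm (s y0 : R) (y : R[i]) : 0 < s -> ~ (~` curve_tail Gamma s) y ->
  y0 < 1 -> \forall y' \near y, forall w, disk w -> F w s = y' -> y0 < cabs w.
Proof.
move=> s0 nUy y01.
have cK : closed ((F^~ s) @` [set w : R[i] | cabs (w - 0) <= y0]).
  apply: compact_closed; first exact: complex_hausdorff.
  apply: continuous_compact; last exact: compact_cabs_le.
  apply: continuous_within => w; rewrite /= subr0 => wy.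
  by apply: (F_continuous s0); rewrite diskE; lra.
have N : nbhs y (~` ((F^~ s) @` [set w : R[i] | cabs (w - 0) <= y0])).
  apply: open_nbhs_nbhs; split; first exact: closed_openC.
  move=> [w /= wy wE]; apply: nUy; rewrite -wE.
  have [fF _ _] := F_bij s0; apply: fF.
  by rewrite diskE; move: wy; rewrite subr0; lra.
apply: (@filterS _ (nbhs y) _ _ _ _ N) => y' /= ny' w dw wE.
rewrite ltNge; apply/negP => wy; apply: ny'; exists w => //.
by rewrite /= subr0.
Qed.

(* A point of the domain close to Gamma(s) lies on a trajectory that is close to the
   unit circle at time s and close to F_T^-1(Gamma(s)) at time T; for s close to T
   this is only possible near the driving point exp(i u(T)). *)
Lemma slit_tip (T e : R) : 0 < T -> 0 < e ->
  (forall s t, 0 <= s <= 1 -> 0 <= t <= 1 -> eta s = eta t -> s = t) ->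
  \forall s \near T, s < T -> cabs (expi (u T) - finv T (Gamma s)) < e.
Proof.
move=> T0 e0 ieta.
have cu : {for T, continuous u}.
  apply: (within_continuous_at continuous_u).
  apply: (@filterS _ (nbhs T) _ _ _ _ (lt_nbhsr T0)) => x /= x0.
  by rewrite in_itv /= ltW.
have clam : {for T, continuous (fun t => expi (u t) : R[i])}.
  by apply: (continuous_comp cu); exact: expi_continuous.
have e8 : 0 < e / 8 by lra.
have N1 : \forall s \near T, cabs (expi (u T) - expi (u s)) < e / 8.
  exact: ((@cvg_cabsP R _ (nbhs T) _ (fun t => expi (u t)) _).1 clam _ e8).
have /nbhs_ballP[d1 /= d10 N1'] := N1.
(* The three bounds keep the driving point within [e / 8] of its value at [T], keep [s] positive,
   and meet the condition on [T - s] in [Loewner_trajectory_bound]. *)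
pose d := Num.min d1 (Num.min T (e ^+ 2 / 256)).
have e2 : 0 < e ^+ 2 / 256 by rewrite divr_gt0 // exprn_gt0.
have d0 : 0 < d by rewrite !lt_min d10 T0.
apply/nbhs_ballP; exists d => //= s; rewrite /ball /= => sd sT.
have sd' : T - s < d by move: sd; rewrite gtr0_norm // subr_gt0.
move: sd'; rewrite !lt_min => /and3P[sd1 sT' se].
have s0 : 0 < s by lra.
have [/andP[r0 r1] Es] := @inverted_curve_time R Gamma l s s0.
have Gs := curve_neq0 s0.
pose y := Gamma s.
have yE : y * eta (s / (1 + s)) = 1 by rewrite Es divff.
have rr : s / (1 + s) < T / (1 + T).
  rewrite ltr_pdivrMr; last by lra.
  rewrite mulrAC ltr_pdivlMr; last by lra.
  lra.
have UTy : (~` curve_tail Gamma T) y.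
  apply/(tail_complement _ T0) => x xT; apply/eqP => yx.
  have : s / (1 + s) = x.
    apply: ieta; [lra|have := rho_gt0 T0; lra|].
    by apply: (mulfI Gs); rewrite yE.
  lra.
have nUsy : ~ (~` curve_tail Gamma s) y.
  by apply; exists s => //; rewrite /= in_itv /= lexx.
have [cly _] : closure Omega0 y /\ ~ Omega0 y.
  apply/boundary_inverted; exists (s / (1 + s)) => //; lra.
have cv := finv_continuous T0 UTy.
have dy := disk_pinv (F_bij T0) UTy.
have fT z : disk z -> f z T = finv T (F0 z) by move=> dz; exact: (f_def dz (ltW T0)).
move: (finv T) cv dy fT => G cv dy fT.
set w := G y.
have dw : cabs w < 1 by rewrite -diskE; exact: dy.
rewrite ltNge; apply/negP => we.
(* Half of the gap at [w], so that [1 - |G y'|^2 > m] persists for [y'] near [y]. *)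
pose m := (1 - cabs w ^+ 2) / 2.
have w2 : cabs w ^+ 2 < 1 by rewrite expr_lt1 // cabs_ge0.
have m0 : 0 < m by rewrite /m; lra.
pose B := expR (32 / e ^+ 2 * (T - s)).
have B0 : 0 < B by exact: expR_gt0.
have B1 : 1 <= B.
  rewrite /B -expR0 ler_expR mulr_ge0 //; last by lra.
  by rewrite divr_ge0 // sqr_ge0.
(* Chosen so that [(1 - y0 ^+ 2) * B = m]: a trajectory with modulus above [y0] at time [s] would
   end with [1 - |f z T|^2 < m], against the choice of [m]. *)
pose y0 := Num.sqrt (1 - m / B).
have mB : m / B <= m by rewrite ler_pdivrMr // ler_peMr // ltW.
have mB0 : 0 < m / B by rewrite divr_gt0.
have m12 : m <= 1 / 2 by rewrite /m; have := sqr_ge0 (cabs w); lra.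
have y0E : y0 ^+ 2 = 1 - m / B by rewrite sqr_sqrtr //; lra.
have y00 : 0 <= y0 by exact: sqrtr_ge0.
have y01 : y0 < 1 by rewrite -(@expr_lt1 _ 2) // y0E; lra.
have c2 : {for w, continuous (fun v => cabs v ^+ 2)}.
  by apply: rcontM; apply: cont_cabs; exact: ccont_id.
have A1 : \forall y' \near y, cabs (w - G y') < e / 2.
  by apply: ((@cvg_cabsP R _ (nbhs y) _ (G) _).1 cv); lra.
have A2 : \forall y' \near y, cabs (G y') ^+ 2 < 1 - m.
  have cv2 : {for y, continuous (fun y' => cabs (G y') ^+ 2)}.
    exact: (continuous_comp cv c2).
  have L : cabs w ^+ 2 < 1 - m by rewrite /m; lra.
  exact: (cvgr_lt _ cv2 _ L).
have A3 := near_tip_norm s0 nUsy y01.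
have [y' [Oy' [[a1 a2] a3]]] := cly _ (@filterI _ (nbhs y) _ _ _ (@filterI _
  (nbhs y) _ _ _ A1 A2) A3).
have [_ [_ _ sF0]] := conformal_F0; have [z dz zy'] := sF0 _ Oy'.
have fTz : f z T = G y' by rewrite (fT _ dz) zy'.
have fs : y0 < cabs (f z s).
  by apply: a3; [exact: f_disk|rewrite (F_f dz s0)].
have := @Loewner_trajectory_bound R (f z) (fun t => expi (u t)) s T s0 sT _ _ _
  (expi (u T)) e e0.
rewrite -/B fTz => H.
have : 1 - cabs (G y') ^+ 2 <= (1 - cabs (f z s) ^+ 2) * B.
  apply: H.
  - by move=> t st; rewrite -diskE; apply: f_disk => //; lra.
  - by move=> t; exact: cabs_expi.
  - by move=> t st; apply: Loewner_ODE => //; lra.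
  - by lra.
  - move=> t st; rewrite cabsC; apply: ltW; apply: N1'; rewrite /ball /=.
    rewrite ger0_norm; lra.
  - have := cabs_tri (expi (u T)) (G y') w.
    by rewrite (cabsC (G y') w) (cabsC (G y') (expi (u T))); lra.
have f2 : y0 ^+ 2 < cabs (f z s) ^+ 2.
  by rewrite ltr_pXn2r // nnegrE ?cabs_ge0.
have : (1 - cabs (f z s) ^+ 2) * B < m.
  by rewrite -ltr_pdivlMr //; lra.
lra.
Qed.

Lemma slit_map (T : R) : 0 < T -> set_inj `[0, 1] eta -> is_slit_map (f^~ T).
Proof.
move=> T0 ieta.
have ieta' s t : 0 <= s <= 1 -> 0 <= t <= 1 -> eta s = eta t -> s = t.
  by move=> s01 t01; apply: ieta; rewrite inE /= in_itv.
have [_ oO _] := domain_Omega0.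
have OX z : (forall s, 0 <= s <= 1 -> z * eta s != 1) -> Omega0 z.
  apply: (arc_not_separating ceta ieta (inverted_curve1 _ _) oO Omega0_0) => v clv.
  have [Ov|nOv] := pselect (Omega0 v); first by left.
  by right; exact: ((boundary_inverted v).1 (conj clv nOv)).
pose rho := T / (1 + T).
have rho0 : 0 < rho by exact: rho_gt0.
have rho1 : rho < 1 by rewrite /rho ltr_pdivrMr ?mul1r; lra.
(* The part of the curve before [T], run backwards: [s = 0] is [Gamma T] and [s = 1] is the limit at
   time 0. That limit is finite because [eta 0] differs from [eta 1 = 0]. *)
pose pt (s : R) : R[i] := (eta ((1 - s) * rho))^-1.
have s_rho (s : R) : 0 <= s <= 1 -> 0 <= (1 - s) * rho <= 1.
  by move=> s01; apply/andP; split; [apply: mulr_ge0|apply: mulr_ile1]; lra.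
have eta_neq0 (s : R) : 0 <= s <= 1 -> eta ((1 - s) * rho) != 0.
  move=> s01; apply/eqP => E.
  have : (1 - s) * rho = 1.
    by apply: ieta'; [exact: s_rho|lra|rewrite E inverted_curve1].
  by nra.
have ptK (s : R) : 0 <= s <= 1 -> pt s * eta ((1 - s) * rho) = 1.
  by move=> s01; rewrite mulVf // eta_neq0.
have Upt (s : R) : 0 < s <= 1 -> (~` curve_tail Gamma T) (pt s).
  move=> s01; have s01' : 0 <= s <= 1 by lra.
  apply/(tail_complement _ T0) => x xT; apply/eqP => px.
  have : (1 - s) * rho = x.
    apply: ieta'; [exact: s_rho|move: xT; rewrite -/rho; lra|].
    have p0 : pt s != 0 by rewrite invr_eq0 eta_neq0.
    by apply: (mulfI p0); rewrite ptK.
  by move: xT; rewrite -/rho; nra.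
have bF := F_bij T0.
have cinv y (Uy : (~` curve_tail Gamma T) y) := finv_continuous T0 Uy.
have invD y (Uy : (~` curve_tail Gamma T) y) := disk_pinv bF Uy.
have invK y (Uy : (~` curve_tail Gamma T) y) := disk_pinvK bF Uy.
have invKV w (dw : disk w) := disk_pinvKV bF dw.
have tip (e : R) (e0 : 0 < e) := slit_tip T0 e0 ieta'.
have fE := f_image T0.
move: (finv T) cinv invD invK invKV tip => G cG GD GK GKV tip.
(* [pt 0] is omitted by [F(., T)], so the value at 0 is set to the driving point; continuity there
   is the content of [slit_tip]. *)
pose gamma (s : R) : R[i] := if s <= 0 then expi (u T) else G (pt s).
have gammaE (s : R) : 0 < s -> gamma s = G (pt s) by move=> s0;
  rewrite /gamma leNgt s0.
have gamma0 : gamma 0 = expi (u T) by rewrite /gamma lexx.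
have gD (s : R) : 0 < s <= 1 -> disk (gamma s).
  by move=> s01; rewrite gammaE; [apply: GD; exact: Upt|case/andP: s01].
have ptI (s t : R) : 0 < s <= 1 -> 0 < t <= 1 -> gamma s = gamma t -> s = t.
  move=> s01 t01; rewrite !gammaE; [|by case/andP: t01|by case/andP: s01].
  move=> /(congr1 (F^~ T)); rewrite /= !GK; [|exact: Upt..].
  move=> /invr_inj E.
  have s01' : 0 <= s <= 1 by lra.
  have t01' : 0 <= t <= 1 by lra.
  have /(mulIf (lt0r_neq0 rho0)) := ieta' _ _ (s_rho _ s01') (s_rho _ t01') E.
  lra.
exists gamma.
  split.
  - apply/subspace_continuousP => s; rewrite /= in_itv /= => s01.
    have [s0|s0] := ltP 0 s; last first.
      have -> : s = 0 by lra.
      apply/(@cvg_cabsP R R (within `[0, 1] (nbhs (0 : R))) _ gamma (gamma 0)) =>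
        e e0.
      (* The original time of [pt x]: for [x > 0] near 0, [pt x = Gamma (tau x)] with
         [tau x < T]. *)
      pose tau (x : R) := (1 - x) * rho / (1 - (1 - x) * rho).
      have tau0 : tau 0 = T.
        rewrite /tau subr0 mul1r /rho; field.
        by rewrite (gt_eqF (_ : 0 < 1 + T)) ?addrK ?oner_eq0 //; lra.
      have ctau : {for (0 : R), continuous tau}.
        have c1 : {for (0 : R), continuous (fun x : R => (1 - x) * rho)}.
          apply: rcontM; last exact: rcont_cst.
          by apply: rcontB; [exact: rcont_cst|move=> A].
        apply: rcontM; first exact: c1.
        apply: rcontV; last by rewrite subr0 mul1r gt_eqF // subr_gt0.
        by apply: rcontB; [exact: rcont_cst|exact: c1].
      have N : \forall x \near (0 : R), tau x < T -> cabs (expi (u T) - G (Gamma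
        (tau x))) < e.
        have tP : nbhs (tau 0) (fun s => s < T -> cabs (expi (u T) - G (Gamma s))
          < e).
          by rewrite tau0; exact: tip.
        exact: (continuous_preimage_nbhs ctau tP).
      have H : \forall x \near (0 : R), `[0, 1]%classic x -> cabs (gamma 0 -
        gamma x) < e.
        apply: (@filterS2 _ (nbhs (0 : R)) _ _ _ _ _ N (lt_nbhsl ltr01)) => x /=
          Nx x1.
        rewrite in_itv /= gamma0 => /andP[x0 _].
        have [x0'|x0'] := leP x 0; first by rewrite /gamma x0' subrr cabs0.
        have r1 : (1 - x) * rho < rho by nra.
        have r0 : 0 < (1 - x) * rho by rewrite mulr_gt0 // subr_gt0.
        have r01 : 0 < (1 - x) * rho < 1 by rewrite r0 (lt_trans r1).
        rewrite gammaE // /pt inverted_curveE // invrK; apply: Nx.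
        rewrite /tau ltr_pdivrMr; last by rewrite subr_gt0; case/andP: r01.
        have rT : rho * (1 + T) = T by rewrite /rho divfK // gt_eqF //; lra.
        nra.
      exact: H.
    have s01' : 0 <= s <= 1 by lra.
    have cpt : {for s, continuous pt}.
      apply: ccontV; last exact: eta_neq0.
      apply: (@continuous_comp _ _ _ (fun s : R => (1 - s) * rho)); last exact: ceta.
      apply: rcontM; last exact: rcont_cst.
      by apply: rcontB; [exact: rcont_cst|move=> A].
    have cGp : {for s, continuous (fun s => G (pt s))}.
      by apply: (continuous_comp cpt); apply: cG; apply: Upt; lra.
    have cgam : {for s, continuous gamma}.
      apply: (continuous_eq_near _ cGp).
      by apply: (@filterS _ (nbhs s) _ _ _ _ (lt_nbhsr s0)) => x; exact: gammaE.
    move=> B nB.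
    have W : within `[0, 1] (nbhs s) (gamma @^-1` B).
      by apply: (@filterS _ (nbhs s) _ _ _ _ (continuous_preimage_nbhs cgam nB))
        => x gx _.
    exact: W.
  - move=> s t; rewrite !inE /= !in_itv /= => /andP[s0 s1] /andP[t0 t1] E.
    have n1 : cabs (gamma 0) = 1 by rewrite gamma0; exact: cabs_expi.
    have [s0'|s0'] := ltP 0 s; have [t0'|t0'] := ltP 0 t.
    + by apply: ptI => //; rewrite ?s0' ?t0'.
    + have tE : t = 0 by lra.
      have := gD s; rewrite s0' s1 => /(_ isT); rewrite diskE E tE n1 ltxx //.
    + have sE : s = 0 by lra.
      have := gD t; rewrite t0' t1 => /(_ isT); rewrite diskE -E sE n1 ltxx //.
    + lra.
  - by rewrite gamma0; exact: norm_expi.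
  - exact: gD.
rewrite fE; apply/seteqP; split=> w.
  move=> [dw Ow]; split=> // -[s]; rewrite /= in_itv /= => s01.
  have s0 : 0 < s by case/andP: s01.
  rewrite gammaE // => sw; move: Ow; rewrite -sw GK; last exact: Upt.
  have s01' : 0 <= s <= 1 by lra.
  by move=> /domain_avoids/(_ (s_rho _ s01')); rewrite ptK // eqxx.
move=> [dw nw]; split=> //; apply: OX => x x01; apply/eqP => wx; apply: nw.
have [fF _ _] := bF; have UFw := fF _ dw.
have xrho : x < rho.
  rewrite ltNge; apply/negP => rx; have := (tail_complement _ T0).1 UFw x.
  by rewrite -/rho rx => /(_ (andP x01).2); rewrite wx eqxx.
pose s := 1 - x / rho.
have xr : 0 <= x / rho < 1.
  by rewrite ltr_pdivrMr // mul1r xrho divr_ge0 ?(ltW rho0) //; case/andP: x01.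
have sE : (1 - s) * rho = x by rewrite /s opprB addrC subrK divfK // gt_eqF.
exists s; first by rewrite /= in_itv /= /s; lra.
rewrite gammaE; last by rewrite /s; lra.
rewrite -[RHS](GKV _ dw); congr G; rewrite /pt sE.
have x0 : eta x != 0 by apply/eqP => E; move: wx; rewrite E mulr0 => /eqP;
  rewrite eq_sym oner_eq0.
by apply: (mulIf x0); rewrite mulVf.
Qed.
End limit.

(** * The two alternatives for the limit of the curve at time 0 *)

Lemma cvg_inv_point (p : R[i]) : p != 0 -> Gamma t @[t --> 0^'+] --> p ->
  (Gamma t)^-1 @[t --> 0^'+] --> p^-1.
Proof. by move=> p0 Gp B nB; exact: (Gp _ (near_invc p0 nB)). Qed.

Lemma cvg_inv_oo : curve_to_sphere Gamma t @[t --> 0^'+] --> sphere_oo R ->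
  (Gamma t)^-1 @[t --> 0^'+] --> (0 : R[i]).
Proof.
move=> Goo; apply/(@cvg_cabsP R R (0^'+) _ (fun t => (Gamma t)^-1) 0) => e e0.
have P : \forall t \near 0^'+, (0 : R) < t by exact: nbhs_right_gt.
have Q : \forall t \near 0^'+, e^-1 < cabs (Gamma t) by exact: sphere_cvg_oo.
apply: (@filterS2 _ (0^'+) _ _ _ _ _ P Q) => t t0 Gt.
by rewrite sub0r cabsN cabsV invf_plt ?posrE ?cabs_gt0 ?curve_neq0.
Qed.

Lemma meets_itself_omits_open (t : R) : meets_itself_once Gamma -> 0 < t ->
  exists (c : R[i]) (U : set R[i]), nbhs c U /\ U `<=` @disk R `\` (f^~ t) @`
    (@disk R).
Proof.
case=> -[r| |//]; rewrite /curve_extended.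
- rewrite lte_fin => r0 /sphere_cvg_point Gr t0.
  have Gl := cvg_inv_point (curve_neq0 r0) Gr.
  have [/andP[r1 r2] E] := @inverted_curve_time R Gamma (Gamma r)^-1 r r0.
  by apply: (open_omitted Gl _ _ t0); last exact/esym/E; rewrite r1 ltW.
- move=> _ /cvg_inv_oo Gl t0.
  by apply: (open_omitted Gl (_ : 0 < 1 <= 1) _ t0);
    rewrite ?ltr01 ?lexx // inverted_curve1.
Qed.

(** An infinite limit at time 0 would itself be a meeting, at [t0 = +oo]. So the limit is a finite
    nonzero [p], different from every [Gamma t], and [p^-1] also differs from [eta 1 = 0]. *)
Lemma not_meets_itself_injective : cvg (curve_to_sphere Gamma t @[t --> 0^'+]) ->
  ~ meets_itself_once Gamma ->
  exists l : R[i], (Gamma t)^-1 @[t --> 0^'+] --> l /\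
    set_inj `[0, 1] (inverted_curve Gamma l).
Proof.
move=> /cvg_ex[[p|]] Gp nm; last by exfalso; apply: nm; exists +oo%E.
have Gp' : Gamma t @[t --> 0^'+] --> p by exact: sphere_cvg_point.
have p0 := curve_limit_neq0 Gp'.
have Gl := cvg_inv_point p0 Gp'; exists p^-1; split=> //.
have H (s t : R) : s <= 0 -> 0 < t <= 1 ->
    inverted_curve Gamma p^-1 s <> inverted_curve Gamma p^-1 t.
  move=> s0 /andP[t0 t1] E; apply: nm.
  have [t1'|t1'] := ltP t 1; last first.
    exfalso; have tE : t = 1 by lra.
    move: E; rewrite tE inverted_curve1 /inverted_curve s0 => /eqP.
    by rewrite invr_eq0 (negbTE p0).
  have t01 : 0 < t < 1 by rewrite t0.
  exists (t / (1 - t))%:E; first by rewrite lte_fin time_gt0.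
  have pE : p = Gamma (t / (1 - t)).
    by apply: invr_inj; move: E; rewrite (inverted_curveE _ _ t01) /inverted_curve s0.
  by rewrite /curve_extended /curve_to_sphere -pE.
move=> s t; rewrite !inE /= !in_itv /= => /andP[s0 s1] /andP[t0 t1] E.
have [s0'|s0'] := ltP 0 s; have [t0'|t0'] := ltP 0 t.
- by apply: (inverted_curve_inj curve_Gamma curve_neq0) E; rewrite ?s0' ?t0'.
- by exfalso; apply: (H t s) => //; rewrite s0'.
- by exfalso; apply: (H s t) => //; rewrite t0'.
- lra.
Qed.
End Loewner_chain.

Theorem theorem1 (R : realType)
  (F0 : R[i] -> R[i]) (Omega0 : set R[i]) (Gamma : R -> R[i])
  (F : R[i] -> R -> R[i]) (u : R -> R) (f : R[i] -> R -> R[i])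
  (* F_0 is a normalized conformal map of the disk onto the domain Omega_0 *)
  (domain_Omega0 : is_domain Omega0)
  (conformal_F0 : conformal_map (@disk R) Omega0 F0)
  (F0_0 : F0 0 = 0) (dF0_0 : derive1 F0 0 = 1)
  (* Omega_0 is bounded by the curve Gamma *)
  (curve_Gamma : open_curve Gamma)
  (boundary_Omega0 :
    curve_hat Gamma = boundary (@to_sphere R @` Omega0))
  (Gamma_oo : curve_to_sphere Gamma t @[t --> +oo] --> sphere_oo R)
  (Gamma_0 : cvg (curve_to_sphere Gamma t @[t --> 0^'+]))
  (param_Gamma : forall t : R, 0 < t ->
    has_conformal_radius (~` curve_tail Gamma t) 0 (expR t))
  (* the chain F(., t) *)
  (conformal_F : forall t : R, 0 < t ->
    [/\ conformal_map (@disk R) (~` curve_tail Gamma t) (F^~ t),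
        F 0 t = 0 & derive1 (F^~ t) 0 = (expR t)%:C])
  (F_init : forall z, disk z -> F z 0 = F0 z)
  (* the continuous driving term and the Loewner PDE *)
  (continuous_u : {within `[0, +oo[, continuous u})
  (Loewner_PDE : forall (z : R[i]) (t : R), disk z -> 0 <= t ->
    has_time_derivative (F z) t
      (z * derive1 (F^~ t) z * ((expi (u t) + z) / (expi (u t) - z))))
  (* f = F^{-1}(F_0(z), t) and the Loewner ODE *)
  (f_def : forall (z : R[i]) (t : R), disk z -> 0 <= t ->
    f z t = 'pinv_(fun=> 0) (@disk R) (F^~ t) (F0 z))
  (f_init : forall z, disk z -> f z 0 = z)
  (Loewner_ODE : forall (z : R[i]) (t : R), disk z -> 0 <= t ->
    has_time_derivative (f z) t
      (- f z t * ((expi (u t) + f z t) / (expi (u t) - f z t)))) :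
  (meets_itself_once Gamma ->
     ~ slit_evolution f /\
     forall t : R, 0 < t ->
       area (@disk R `\` (f^~ t) @` (@disk R)) != 0%E /\
       ~ is_slit_map (f^~ t))
  /\
  (~ meets_itself_once Gamma -> slit_evolution f).
Proof.
have cF (t : R) (t0 : 0 < t) : conformal_map (@disk R) (~` curve_tail Gamma t) (F^~ t).
  by have [] := conformal_F t t0.
split=> [meets|not_meets]; last first.
  have [l [Gl il]] := not_meets_itself_injective domain_Omega0 conformal_F0 F0_0 curve_Gamma
    boundary_Omega0 Gamma_0 not_meets.
  move=> T T0; exact: (slit_map domain_Omega0 conformal_F0 F0_0 curve_Gamma
    boundary_Omega0 Gamma_oo cF f_def Gl continuous_u Loewner_ODE T0 il).
have main (t : R) : 0 < t ->
    area (@disk R `\` (f^~ t) @` (@disk R)) != 0%E /\ ~ is_slit_map (f^~ t).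
  move=> t0; have [c [U [nU Uf]]] := meets_itself_omits_open domain_Omega0 conformal_F0 F0_0
    curve_Gamma boundary_Omega0 Gamma_oo cF f_def meets t0.
  split; first exact: (area_gt0 nU Uf).
  (* For a slit map the omitted open set [U] would lie on the slit, but an injective arc contains no
     open set. *)
  move=> [gamma [cg ig _ _] fg]; apply: (slit_interior_empty cg ig nU) => w Uw.
  have [dw nfw] := Uf w Uw.
  apply: contrapT => ng; apply: nfw; rewrite fg; split=> // -[s s01 sw].
  apply: ng; exists s => //; move: s01; rewrite /= !in_itv /=.
  by case/andP=> /ltW -> ->.
split=> // slit; exact: (main 1 ltr01).2 (slit 1 ltr01).
Qed.
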